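(* Let $n\ge 3$, let $a_0,a_1,\ldots,a_n$ be nonnegative integers, put $a=a_1+\cdots+a_n$, and let $r,s,t$ be fixed integers with $1\le r<s\le n$, $1\le t<s$ and $t\ne r$. Then $$\mathop{\mathrm{CT}}_{\mathbf{x}}\frac{x_rx_s}{x_0x_t}\,D_n(\mathbf{x},\mathbf{a},q)=q^{\widetilde{L}(r,s,t)}\left(\frac{(1-q^{a_0})(1-q^{a_t})\Big((1-q^{a_0+a+1})+q^{M(r,s,t)}(1-q^{a+1-a_t})\Big)}{(1-q^{a+1-a_t})(1-q^{a+1})(1-q^{a_0+a+1-a_t})}\right)\frac{(q)_{a+a_0}}{(q)_{a_0}(q)_{a_1}\cdots(q)_{a_n}},$$ where $$\widetilde{L}(r,s,t)=\begin{cases}\sum_{k=1}^{r-1}a_k+\sum_{k=t+1}^{s-1}a_k, & \text{if } r<t<s,\\ \sum_{k=r}^{s-1}a_k+\sum_{k=1}^{t-1}a_k+2\sum_{k=t+1}^{r-1}a_k, & \text{if } t<r<s,\end{cases}$$ and $$M(r,s,t)=\begin{cases}1+a+a_0, & \text{if } r<t<s,\\ a_t, & \text{if } t<r<s.\end{cases}$$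
   Context: Here $q$ is an indeterminate, $\mathbf{x}=(x_0,\ldots,x_n)$, $\mathbf{a}=(a_0,\ldots,a_n)$, and $(z)_k=(1-z)(1-zq)\cdots(1-zq^{k-1})$ for integers $k\ge 0$. The $q$-Dyson product is $$D_n(\mathbf{x},\mathbf{a},q)=\prod_{0\le i<j\le n}\left(\frac{x_i}{x_j}\right)_{a_i}\left(\frac{x_j}{x_i}q\right)_{a_j}.$$ $\mathop{\mathrm{CT}}_{\mathbf{x}}F(\mathbf{x})$ denotes the constant term of $F$ in the variables $x_0,\ldots,x_n$. Note that $a$ does not include $a_0$. *)

(* Defs.v *)
From HB Require Import structures.
From mathcomp Require Import all_boot all_order all_algebra.
From mathcomp Require Import mpoly.

Set Implicit Arguments.
Unset Strict Implicit.
Unset Printing Implicit Defensive.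

Import GRing.Theory.
Local Open Scope ring_scope.

Definition qpoch (R : pzRingType) (q z : R) (k : nat) : R :=
  \prod_(i < k) (1 - z * q ^+ i).

Definition qDyson (L : fieldType) (n : nat)
    (x : 'I_n.+1 -> L) (a : 'I_n.+1 -> nat) (q : L) : L :=
  \prod_(i < n.+1) \prod_(j < n.+1 | (i < j)%N)
     (qpoch q (x i / x j) (a i) * qpoch q (x j / x i * q) (a j)).

(* F(q); the base field F is not fixed, so F(q) may be Q(q), C(q), and so on. *)
Definition qfield (F : fieldType) : fieldType := {fraction {poly F}}.

Definition qvar (F : fieldType) : qfield F := tofrac 'X.

(* The field K(x_0, ..., x_n), in which Laurent polynomials are the fractions
   whose denominator is a monomial. *)
Definition ratfun (K : fieldType) (n : nat) : fieldType :=
  {fraction {mpoly K[n.+1]}}.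

Definition xvar (K : fieldType) (n : nat) (i : 'I_n.+1) : ratfun K n :=
  tofrac 'X_i.

Definition ratfunC (K : fieldType) (n : nat) (c : K) : ratfun K n :=
  tofrac c%:MP.

(* [CT f c]: f is a Laurent polynomial P / x^m and its constant term is c,
   that is, c is the coefficient of x^m in P. *)
Definition CT (K : fieldType) (n : nat) (f : ratfun K n) (c : K) : Prop :=
  exists (P : {mpoly K[n.+1]}) (m : 'X_{1..n.+1}),
    f = tofrac P / tofrac 'X_[m] /\ c = P@_m.

Lemma CT_unique (K : fieldType) (n : nat) (f : ratfun K n) (c c' : K) :
  CT f c -> CT f c' -> c = c'.
Proof.
have X_neq0 (m : 'X_{1..n.+1}) : tofrac ('X_[m] : {mpoly K[n.+1]}) != 0.
  rewrite tofrac_eq0; apply/eqP => /(congr1 (mcoeff m)) /eqP.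
  by rewrite mcoeffX eqxx mcoeff0 oner_eq0.
move=> [P [m [fE ->]]] [P' [m' [fE' ->]]].
move: fE'; rewrite fE => /eqP; rewrite eqr_div ?X_neq0 //.
rewrite -!tofracM tofrac_eq => /eqP /(congr1 (mcoeff (m' + m)%MM)).
by rewrite mcoeffMX addmC mcoeffMX.
Qed.

(* a_1 + ... + a_n: a_0 is left out. For t >= 1 one has a t <= asum a, so the
   truncated subtraction in exponents such as asum a + 1 - a t is exact. *)
Definition asum (n : nat) (a : 'I_n.+1 -> nat) : nat :=
  (\sum_(k < n.+1 | 1 <= k) a k)%N.

(* In Ltilde and Mexp the [else] branch is the case t < r, as t != r. *)
Definition Ltilde (n : nat) (a : 'I_n.+1 -> nat) (r s t : 'I_n.+1) : nat :=
  (if r < t then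
     \sum_(k < n.+1 | 1 <= k < r) a k + \sum_(k < n.+1 | t < k < s) a k
   else
     \sum_(k < n.+1 | r <= k < s) a k + \sum_(k < n.+1 | 1 <= k < t) a k
       + 2 * \sum_(k < n.+1 | t < k < r) a k)%N.

Definition Mexp (n : nat) (a : 'I_n.+1 -> nat) (r t : 'I_n.+1) : nat :=
  (if r < t then 1 + asum a + a ord0 else a t)%N.

(* Main.v *)
Require Import Defs.
From mathcomp Require Import all_boot all_order all_algebra.
From mathcomp Require Import mpoly.
From mathcomp Require Import zify ring.

Set Implicit Arguments.
Unset Strict Implicit.
Unset Printing Implicit Defensive.

Import GRing.Theory.
Local Open Scope ring_scope.

(** The constant term is the coefficient of a single monomial in x_r x_s times
    the homogeneous polynomial F obtained from the q-Dyson product by clearing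
    denominators, and the proof reads it off from finitely many values of that
    polynomial, in the manner of Karolyi and Nagy.

    If p has total degree at most |D|, then its coefficient at X^D is the sum of
    p(c) / prod_i phi_i'(c_i) over a grid A_0 x ... x A_n with |A_i| = D_i + 1
    and phi_i the monic polynomial that vanishes on A_i
    ([mcoeff_interpolation]).  Nodes are taken to be powers of q.  A factor of F
    vanishes at (q^alpha_i) unless, for each pair, one of the intervals
    [alpha_i, alpha_i + a_i) lies before the other, with an extra unit gap when
    the pair appears in the wrong order ([packed]).  The grid is barely wide
    enough for intervals of total length a_0 + ... + a_n, so a configuration
    without slack is rigid ([packed_rigid]), and one unit of room more for x_0
    and for x_t allows only a few further points ([packed_second_slack]).  As
    lower order terms do not affect the coefficient, x_r x_s may be replaced by
    (x_r - u)(x_s - v), and u, v are chosen to kill some of the surviving points.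
    At a point that follows a chain of adjacent intervals the quotient
    F / prod_i phi_i' telescopes to the q-multinomial coefficient; this is the
    q-Dyson theorem ([dyson_prod_chain]).

    With the natural order of the variables the points in which x_t takes its
    extra node are exponentially many.  So the product is also considered with t
    moved immediately behind 0 in the order.  For that order only four points
    survive, two of which are killed; the other two give the two summands of the
    formula ([mcoeff_front]).  To compare the two orders, x_t is given the extra
    node 0.  When x_t = 0 the two products are proportional
    ([dyson_prod_front_zero]), and of the points with x_t <> 0 only the natural
    chain can contribute, and only when r < t ([mcoeff_natural_front]).
    That contribution accounts for the two shapes of M(r,s,t). *)

(** * Interpolation on a product grid *)

(** The left hand side is the coefficient of 'X^D in the Lagrange interpolant
    of 'X^m, which reproduces 'X^m because m <= D. *)
Lemma divided_difference_exp (K : fieldType) (g : nat -> K) (D m : nat) :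
  injective g -> (m <= D)%N ->
  \sum_(k < D.+1) g k ^+ m / \prod_(l < D.+1 | l != k) (g k - g l)
  = (m == D)%:R.
Proof.
move=> g_inj le_mD.
have := lagrange_gen (ltn0Sn D) g_inj (p := 'X^m).
rewrite size_polyXn ltnS => /(_ le_mD) /(congr1 (fun p : {poly K} => p`_D)).
rewrite coefXn eq_sym => ->; rewrite coef_sum; apply: eq_bigr => k _.
rewrite hornerXn (lagrangeE _ g_inj) //= mulrA -polyCM coefCM horner_prod.
pose p : {poly K} := \prod_(l < D.+1 | l != k) ('X - (g l)%:P).
rewrite -/p.
have p_monic : p \is monic by rewrite monic_prod_XsubC.
have szp : size p = D.+1.
  rewrite /p -big_filter size_prod_XsubC size_filter -sum1_count sum1_card.
  by rewrite cardC1 card_ord.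
have := monicP p_monic; rewrite /lead_coef szp /= => ->; rewrite mulr1.
by under [in RHS]eq_bigr do rewrite hornerXsubC.
Qed.

(** By linearity p may be taken to be a monomial X^m, and then the sum factors
    into univariate divided differences.  If m <> D and |m| <= |D|, some m_i is
    smaller than D_i, and the factor of that i vanishes.  The bound M only serves
    to make the set of index functions a finite type. *)
Lemma mcoeff_interpolation (K : fieldType) (N M : nat)
    (g : 'I_N -> nat -> K) (D : 'X_{1..N}) (p : {mpoly K[N]}) :
  (forall i, injective (g i)) -> (forall i, D i < M)%N ->
  (msize p <= (mdeg D).+1)%N ->
  p@_D = \sum_(f : {ffun 'I_N -> 'I_M} | [forall i, f i <= D i]%N)
           p.@[fun i => g i (f i)]
           / \prod_i \prod_(l < (D i).+1 | l != f i :> nat)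
               (g i (f i) - g i l).
Proof.
move=> g_inj ltDM szp.
have monom (m : 'X_{1..N}) : (mdeg m <= mdeg D)%N ->
    \sum_(f : {ffun 'I_N -> 'I_M} | [forall i, f i <= D i]%N)
      (\prod_i g i (f i) ^+ m i)
      / \prod_i \prod_(l < (D i).+1 | l != f i :> nat) (g i (f i) - g i l)
    = (m == D)%:R.
  move=> le_mD.
  under eq_bigr do rewrite -prodf_div.
  rewrite (eq_bigl (mem (family (fun i => [pred k : 'I_M | k <= D i]%N)))).
    rewrite -(bigA_distr_big_dep _ (fun i (k : 'I_M) => g i k ^+ m i /
       \prod_(l < (D i).+1 | l != k :> nat) (g i k - g i l))) /=.
    have inner i : \sum_(k < M | (k <= D i)%N) g i k ^+ m i /
        \prod_(l < (D i).+1 | l != k :> nat) (g i k - g i l) =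
        \sum_(k < (D i).+1) g i k ^+ m i /
        \prod_(l < (D i).+1 | l != k) (g i k - g i l).
      exact: esym (big_ord_widen M (fun k => g i k ^+ m i /
        \prod_(l < (D i).+1 | l != k :> nat) (g i k - g i l)) (ltDM i)).
    under eq_bigr do rewrite inner.
    have [/mnm_lepP le_Dm | /mnm_lepP] := boolP (D <= m)%MM.
      have eq_mD : m = D.
        apply/mnmP => i.
        move: le_mD; rewrite !mdegE => le_mD.
        apply/eqP; rewrite eqn_leq le_Dm andbT leqNgt; apply/negP => lt_Dm.
        move: le_mD; rewrite leqNgt (bigD1 i) //= [X in (_ < X)%N](bigD1 i) //=.
        by rewrite -addSn leq_add // leq_sum.
      rewrite eq_mD eqxx big1 // => i _.
      by rewrite divided_difference_exp // eqxx.
    move=> not_le; have [i lt_mD] : exists i, (m i < D i)%N.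
      apply/existsP; apply: contra_notT not_le; rewrite negb_exists.
      by move=> /forallP le_Dm i; rewrite leqNgt.
    have /negPf-> : m != D by apply: contraTneq lt_mD => ->; rewrite ltnn.
    rewrite (bigD1 i) //= divided_difference_exp ?(ltnW lt_mD) //.
    by rewrite (ltn_eqF lt_mD) mul0r.
  by move=> f; rewrite inE; apply/forallP/familyP.
under eq_bigr do rewrite mevalE mulr_suml.
rewrite exchange_big /= {1}[p]mpolyE raddf_sum /=.
rewrite big_seq [RHS]big_seq; apply: eq_bigr => m m_in.
rewrite mcoeffZ mcoeffX -monom; last first.
  by rewrite -ltnS (leq_trans _ szp) // msize_mdeg_lt.
by rewrite mulr_sumr; apply: eq_bigr => f _; rewrite mulrA.
Qed.

(** The contribution of one grid point to the interpolation formula. *)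
Definition interp_term (K : fieldType) (N : nat) (g : 'I_N -> nat -> K)
    (D : 'X_{1..N}) (p : {mpoly K[N]}) (alpha : 'I_N -> nat) : K :=
  p.@[fun i => g i (alpha i)]
  / \prod_i \prod_(l < (D i).+1 | l != alpha i :> nat) (g i (alpha i) - g i l).

Section FewPoints.
Variables (K : fieldType) (N : nat) (g : 'I_N -> nat -> K) (D : 'X_{1..N}).
Variable p : {mpoly K[N]}.
Hypothesis g_inj : forall i, injective (g i).
Hypothesis szp : (msize p <= (mdeg D).+1)%N.
Implicit Types alpha beta : 'I_N -> nat.

Lemma eq_interp_term alpha beta : alpha =1 beta ->
  interp_term g D p alpha = interp_term g D p beta.
Proof.
move=> eq_ab; rewrite /interp_term; congr (_ / _).
  by apply: meval_eq => i; rewrite eq_ab.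
by apply: eq_bigr => i _; rewrite eq_ab.
Qed.

Lemma mcoeff_two_points alpha beta (i0 : 'I_N) :
  alpha i0 != beta i0 ->
  (forall i, alpha i <= D i)%N -> (forall i, beta i <= D i)%N ->
  (forall gamma, (forall i, gamma i <= D i)%N ->
     p.@[fun i => g i (gamma i)] != 0 -> gamma =1 alpha \/ gamma =1 beta) ->
  p@_D = interp_term g D p alpha + interp_term g D p beta.
Proof.
move=> neq_ab le_a le_b only.
have ltDM i : (D i < (mdeg D).+1)%N.
  by rewrite ltnS mdegE (bigD1 i) //= leq_addr.
rewrite (mcoeff_interpolation g_inj ltDM szp).
pose pt (c : 'I_N -> nat) : {ffun 'I_N -> 'I_(mdeg D).+1} := [ffun i => inord (c i)].
have ptE c : (forall i, c i <= D i)%N -> (fun i => pt c i : nat) =1 c.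
  by move=> le_c i; rewrite ffunE inordK // (leq_ltn_trans (le_c i)).
have pt_in c : (forall i, c i <= D i)%N -> [forall i, pt c i <= D i]%N.
  by move=> le_c; apply/forallP => i; rewrite ptE.
rewrite (bigD1 (pt alpha)) ?pt_in //=; congr (_ + _).
  exact: (@eq_interp_term (fun i => pt alpha i) alpha (ptE _ le_a)).
rewrite (bigD1 (pt beta)) /=; last first.
  rewrite pt_in //; apply: contraNneq neq_ab => /ffunP/(_ i0).
  by move/(congr1 val); rewrite /= !ptE // => ->.
rewrite [X in _ + X]big1 ?addr0; first exact: (@eq_interp_term (fun i => pt beta i)
  beta (ptE _ le_b)).
move=> f /andP[/andP[/forallP le_f neq_fa] neq_fb].
have [->|nz] := eqVneq p.@[fun i => g i (f i)] 0; first by rewrite mul0r.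
case: (only (fun i => f i) le_f nz) => eq_f.
  by case/eqP: neq_fa; apply/ffunP => i; apply: val_inj; rewrite /= ptE.
by case/eqP: neq_fb; apply/ffunP => i; apply: val_inj; rewrite /= ptE.
Qed.

Lemma mcoeff_one_point alpha :
  (forall i, alpha i <= D i)%N ->
  (forall gamma, (forall i, gamma i <= D i)%N ->
     p.@[fun i => g i (gamma i)] != 0 -> gamma =1 alpha) ->
  p@_D = interp_term g D p alpha.
Proof.
move=> le_a only.
have ltDM i : (D i < (mdeg D).+1)%N.
  by rewrite ltnS mdegE (bigD1 i) //= leq_addr.
rewrite (mcoeff_interpolation g_inj ltDM szp).
pose pt : {ffun 'I_N -> 'I_(mdeg D).+1} := [ffun i => inord (alpha i)].
have ptE : (fun i => pt i : nat) =1 alpha.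
  by move=> i; rewrite ffunE inordK // (leq_ltn_trans (le_a i)).
rewrite (bigD1 pt) /=; last by apply/forallP => i; rewrite ptE.
rewrite [X in _ + X]big1 ?addr0; first exact: (@eq_interp_term (fun i => pt i)
  alpha ptE).
move=> f /andP[/forallP le_f neq_f].
have [->|nz] := eqVneq p.@[fun i => g i (f i)] 0; first by rewrite mul0r.
have eq_f := only (fun i => f i) le_f nz.
by case/eqP: neq_f; apply/ffunP => i; apply: val_inj; rewrite /= ptE.
Qed.

End FewPoints.

(** * Packings of intervals *)

Section Packing.
Variables (I : finType) (a : I -> nat).
Implicit Types (rho alpha : I -> nat) (T : {set I}).

Definition prefix_sum rho T (i : I) : nat :=
  \sum_(k in T | (rho k < rho i)%N) a k.

(** The intervals [alpha i, alpha i + a i) are disjoint, and there is a gap of at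
    least one unit whenever a later interval belongs to an index of lower rank. *)
Definition packed rho T alpha : Prop :=
  forall i j, i \in T -> j \in T -> (rho i < rho j)%N ->
    (alpha i + a i <= alpha j)%N || (alpha j + a j < alpha i)%N.

Lemma packed_subset rho T T' alpha :
  T' \subset T -> packed rho T alpha -> packed rho T' alpha.
Proof. by move=> /subsetP sT pk i j iT jT; apply: pk; apply: sT. Qed.

Lemma prefix_sumD1 rho T (m i : I) : m \in T -> (rho i <= rho m)%N ->
  prefix_sum rho (T :\ m) i = prefix_sum rho T i.
Proof.
move=> mT le_im; apply: eq_bigl => k; rewrite in_setD1.
by case: eqVneq => [->|//]; rewrite mT /= ltnNge le_im.
Qed.

Lemma prefix_sum_max rho T (m : I) : injective rho -> m \in T ->
  (forall i, i \in T -> rho i <= rho m)%N ->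
  prefix_sum rho T m = (\sum_(k in T :\ m) a k)%N.
Proof.
move=> rho_inj mT max_m; apply: eq_bigl => k; rewrite in_setD1 andbC.
case: (boolP (k \in T)) => kT; last by rewrite !andbF.
by rewrite !andbT ltn_neqAle max_m // andbT (inj_eq rho_inj).
Qed.

Lemma prefix_sum_le rho T (i : I) :
  (prefix_sum rho T i <= \sum_(k in T :\ i) a k)%N.
Proof.
rewrite /prefix_sum big_mkcondr [X in (_ <= X)%N]big_mkcond /=.
rewrite [X in (X <= _)%N]big_mkcond /=.
apply: leq_sum => k _; rewrite in_setD1; case: (k \in T); rewrite ?andbF //=.
by case: (eqVneq k i) => [->|]; [rewrite ltnn | case: ifP].
Qed.

Lemma rank_max rho T : T != set0 ->
  exists2 m, m \in T & forall i, i \in T -> (rho i <= rho m)%N.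
Proof.
case/set0Pn => i0 i0T; case: (arg_maxnP rho i0T) => m mT max_m.
by exists m.
Qed.

(** The interval with the largest left end, ties being broken by rank, lies after
    all the others. *)
Lemma packed_top rho T alpha : injective rho -> T != set0 ->
  packed rho T alpha ->
  exists2 i, i \in T & forall j, j \in T -> j != i ->
    (alpha j + a j + (rho i < rho j) <= alpha i)%N.
Proof.
move=> rho_inj T0 pk; have [m mT max_m] := rank_max rho T0.
(* lexicographic comparison of position and rank, in base rho m + 1 *)
have [i iT max_i] :=
  rank_max (fun i => alpha i * (rho m).+1 + rho i)%N T0.
exists i => // j jT neq_ji.
have := max_i j jT; have := max_m i iT; have := max_m j jT.
have := ltngtP (rho i) (rho j); case => [lt_ij|lt_ji|/rho_inj eq_ij].
- have := pk i j iT jT lt_ij.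
  case/orP => ?; last by lia.
  by nia.
- have := pk j i jT iT lt_ji.
  case/orP => ?; first by lia.
  by nia.
- by rewrite eq_ij eqxx in neq_ji.
Qed.

(** A window whose length is the total length of the intervals leaves no room
    for a gap, so the intervals follow each other in the order of the ranks.
    Removing the topmost interval leaves a packing of the same kind. *)
Lemma packed_rigid rho T alpha : injective rho -> packed rho T alpha ->
  (forall i, i \in T -> alpha i + a i <= \sum_(k in T) a k)%N ->
  {in T, alpha =1 prefix_sum rho T}.
Proof.
move=> rho_inj; move: {2}#|T| (leqnn #|T|) => n.
elim: n T => [|n IHn] T; rewrite ?leqn0.
  by rewrite cards_eq0 => /eqP-> _ _ i; rewrite inE.
move=> cardT pk bnd; have [->|T0] := eqVneq T set0; first by move=> i; rewrite inE.
have [i iT top_i] := packed_top rho_inj T0 pk.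
have sumT : (\sum_(k in T) a k = a i + \sum_(k in T :\ i) a k)%N.
  by rewrite (big_setD1 i).
have IH : {in T :\ i, alpha =1 prefix_sum rho (T :\ i)}.
  apply: IHn.
  - by move: cardT; rewrite (cardsD1 i) iT.
  - exact: packed_subset (subD1set _ _) pk.
  move=> j /setD1P[neq_ji jT]; move: (top_i j jT neq_ji) (bnd i iT).
  by rewrite sumT; lia.
have [Ti0|Ti0] := eqVneq (T :\ i) set0.
  have eqT j : j \in T -> j = i.
    move=> jT; apply/eqP; apply: contraT => neq_ji.
    by have := in_set0 j; rewrite -Ti0 in_setD1 neq_ji jT.
  move=> j jT; rewrite (eqT j jT) prefix_sum_max //; last by move=> k /eqT->.
  by move: (bnd i iT); rewrite sumT Ti0 big_set0; lia.
have [m /setD1P[neq_mi mT] max_m] := rank_max rho Ti0.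
have alpha_m : (alpha m + a m = \sum_(k in T :\ i) a k)%N.
  have mTi : m \in T :\ i by rewrite in_setD1 neq_mi.
  rewrite IH // prefix_sum_max // addnC.
  by rewrite [RHS](big_setD1 m).
have lt_mi : (rho m < rho i)%N.
  rewrite ltnNge leq_eqVlt (inj_eq rho_inj) eq_sym (negPf neq_mi) /=.
  apply/negP => lt_im; move: (top_i m mT neq_mi) (bnd i iT).
  by rewrite sumT lt_im; lia.
have max_i j : j \in T -> (rho j <= rho i)%N.
  move=> jT; have [->//|neq_ji] := eqVneq j i.
  by rewrite (leq_trans _ (ltnW lt_mi)) // max_m // in_setD1 neq_ji.
move=> j jT; have [->|neq_ji] := eqVneq j i; last first.
  by rewrite IH ?in_setD1 ?neq_ji // prefix_sumD1 ?max_i.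
rewrite prefix_sum_max //; move: (top_i m mT neq_mi) (bnd i iT).
by rewrite sumT; lia.
Qed.

End Packing.

(** Index z is moved behind all the others. *)
Definition rank_last (I : finType) (z : I) (rho : I -> nat) (k : I) : nat :=
  if k == z then (\max_i rho i).+1 else rho k.

Lemma rank_last_inj (I : finType) (z : I) (rho : I -> nat) :
  injective rho -> injective (rank_last z rho).
Proof.
move=> rho_inj i j; rewrite /rank_last.
case: eqP => [->|_]; case: eqP => [->//|_].
- by move=> eqm; have := leq_bigmax (F := rho) j; rewrite -eqm ltnn.
- by move=> eqm; have := leq_bigmax (F := rho) i; rewrite eqm ltnn.
- exact: rho_inj.
Qed.

Lemma rank_last_lt (I : finType) (z i : I) (rho : I -> nat) :
  i != z -> (rank_last z rho i < rank_last z rho z)%N.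
Proof. by move=> /negPf neq; rewrite /rank_last neq eqxx ltnS leq_bigmax. Qed.

Section Slack.
Variables (I : finType) (a : I -> nat).
Implicit Types (rho alpha : I -> nat) (T : {set I}).
Local Notation room T i := (\sum_(k in T :\ i) a k)%N.

Lemma prefix_sumD1_before rho T (z i : I) : z \in T -> (rho z < rho i)%N ->
  prefix_sum a rho T i = (a z + prefix_sum a rho (T :\ z) i)%N.
Proof.
move=> zT lt_zi; rewrite /prefix_sum (bigD1 z) /=; last by rewrite zT lt_zi.
congr (_ + _)%N; apply: eq_bigl => k; rewrite in_setD1 andbC andbA.
by rewrite andbAC.
Qed.

Lemma prefix_sum_rank_last rho (z i : I) : i != z ->
  prefix_sum a (rank_last z rho) setT i = prefix_sum a rho (setT :\ z) i.
Proof.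
move=> neq_iz; apply: eq_bigl => k; rewrite !inE /rank_last (negPf neq_iz).
case: (eqVneq k z) => //= _; apply/negbTE.
by rewrite -leqNgt ltnW // ltnS leq_bigmax.
Qed.

Lemma prefix_sum_rank_last_self rho (z : I) :
  prefix_sum a (rank_last z rho) setT z = room setT z.
Proof.
apply: eq_bigl => k; rewrite !inE andbT /=.
by case: (eqVneq k z) => [->|/rank_last_lt->]; rewrite ?ltnn.
Qed.

Lemma packed_tight rho T alpha : injective rho -> packed a rho T alpha ->
  (forall i, i \in T -> alpha i <= room T i)%N ->
  {in T, alpha =1 prefix_sum a rho T}.
Proof.
move=> rho_inj pk bnd; apply: packed_rigid => // i iT.
by rewrite (big_setD1 i) //= addnC leq_add2l bnd.
Qed.

(** If z exceeds its room by one unit, its interval ends at the right edge of the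
    window, which forces all the others to its left. *)
Lemma packed_overflow rho T alpha z : injective rho -> z \in T ->
  packed a rho T alpha -> alpha z = (room T z).+1 ->
  (forall j, j \in T -> j != z -> alpha j <= room T j + (rho j < rho z))%N ->
  forall j, j \in T :\ z ->
    (alpha j + a j <= room T z + (rho j < rho z)%N)%N.
Proof.
move=> rho_inj zT pk alpha_z bnd j /setD1P[neq_jz jT].
have := bnd j jT neq_jz.
have sumz : (\sum_(k in T) a k = a z + room T z)%N by rewrite (big_setD1 z).
have sumj : (\sum_(k in T) a k = a j + room T j)%N by rewrite (big_setD1 j).
have := pk j z jT zT; have := pk z j zT jT; rewrite alpha_z.
move: sumj sumz; move: (\sum_(k in T) a k)%N (room T j) (room T z) => s1 s2 s3.
case: (ltngtP (rho j) (rho z)) => [_|_|/rho_inj eq_jz] sumj sumz;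
  rewrite ?addn0 ?addn1; last by rewrite eq_jz eqxx in neq_jz.
- by move=> _ /(_ isT) /orP[]; lia.
- by move=> /(_ isT) /orP[]; lia.
Qed.

(** One extra unit of room for the index of lowest rank admits, besides the rigid
    configuration, only the one in which that index has moved to the far end. *)
Lemma packed_first_slack rho T alpha z : injective rho -> z \in T ->
  (forall i, i \in T -> i != z -> rho z < rho i)%N ->
  packed a rho T alpha ->
  (forall i, i \in T -> alpha i <= room T i + (i == z))%N ->
  {in T, alpha =1 prefix_sum a rho T} \/
  alpha z = (room T z).+1 /\ {in T :\ z, alpha =1 prefix_sum a rho (T :\ z)}.
Proof.
move=> rho_inj zT min_z pk bnd.
have bnd' i : i \in T -> i != z -> (alpha i <= room T i)%N.
  by move=> iT neq_iz; move: (bnd i iT); rewrite (negPf neq_iz) addn0.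
have := bnd z zT; rewrite eqxx addn1 leq_eqVlt ltnS => /orP[/eqP alpha_z|le_z].
  right; split=> //; apply: packed_rigid => //.
    exact: packed_subset (subD1set _ _) pk.
  move=> i iTz; have /setD1P[neq_iz iT] := iTz.
  have := packed_overflow rho_inj zT pk alpha_z _ iTz.
  rewrite ltnNge (ltnW (min_z i iT neq_iz)) addn0; apply => j jT neq_jz.
  by rewrite (leq_trans (bnd' j jT neq_jz)) ?leq_addr.
left; apply: packed_tight => // i iT.
by have [->//|neq_iz] := eqVneq i z; apply: bnd'.
Qed.

(** The extra room of the two lowest indices may be used by either of them, by
    both or by neither.  When both have moved to the far end, only the positions
    of the other indices are recorded. *)
Lemma packed_second_slack rho T alpha z t : injective rho ->
  z \in T -> t \in T -> t != z -> (rho z < rho t)%N ->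
  (forall i, i \in T -> i != z -> i != t -> rho t < rho i)%N ->
  packed a rho T alpha ->
  (forall i, i \in T -> alpha i <= room T i + (i == z) + (i == t))%N ->
  [\/ {in T, alpha =1 prefix_sum a rho T},
      alpha z = (room T z).+1 /\ {in T :\ z, alpha =1 prefix_sum a rho (T :\ z)},
      alpha t = (room T t).+1 /\ {in T :\ t, alpha =1 prefix_sum a rho (T :\ t)}
    | {in T :\ t :\ z, alpha =1 prefix_sum a rho (T :\ t :\ z)}].
Proof.
move=> rho_inj zT tT neq_tz lt_zt min_t pk bnd.
have min_z i : i \in T -> i != z -> (rho z < rho i)%N.
  move=> iT neq_iz; have [->//|neq_it] := eqVneq i t.
  exact: ltn_trans lt_zt (min_t i iT neq_iz neq_it).
have := bnd t tT; rewrite eqxx (negPf neq_tz) addn0 addn1 leq_eqVlt ltnS.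
case/orP => [/eqP alpha_t|le_t].
  have pk' := packed_subset (subD1set T t) pk.
  have zTt : z \in T :\ t by rewrite in_setD1 eq_sym neq_tz.
  have bnd' i : i \in T :\ t -> (alpha i <= room (T :\ t) i + (i == z))%N.
    move=> iTt; have /setD1P[neq_it iT] := iTt.
    have := packed_overflow rho_inj tT pk alpha_t _ iTt.
    have -> : (rho i < rho t)%N = (i == z).
      case: (eqVneq i z) => [->|neq_iz]; first by rewrite lt_zt.
      by rewrite ltnNge ltnW // min_t.
    rewrite [X in (_ <= X + _)%N](big_setD1 i) //= addnC -addnA leq_add2l; apply.
    move=> j jT neq_jt; have := bnd j jT; rewrite (negPf neq_jt) addn0.
    case: (eqVneq j z) => [->|_]; first by rewrite lt_zt.
    by move=> /leq_trans; apply; rewrite leq_add2l.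
  case: (packed_first_slack rho_inj zTt _ pk' bnd').
  - by move=> i /setD1P[_ iT]; apply: min_z.
  - by move=> eqS; apply: Or43.
  - by case=> _ eqS; apply: Or44.
have bnd' i : i \in T -> (alpha i <= room T i + (i == z))%N.
  move=> iT; have [->|neq_it] := eqVneq i t;
    first by rewrite (leq_trans le_t) ?leq_addr.
  by move: (bnd i iT); rewrite (negPf neq_it) addn0.
case: (packed_first_slack rho_inj zT min_z pk bnd') => [eqS|[alpha_z eqS]].
  exact: Or41.
by apply: Or42.
Qed.

End Slack.

(** * Chains of intervals *)

(** Induction on a finite set by adjoining elements above the present ones. *)
Lemma rank_ind (I : finType) (rho : I -> nat) (P : {set I} -> Prop) :
  injective rho -> P set0 ->
  (forall (T : {set I}) m, m \notin T ->
     (forall i, i \in T -> (rho i < rho m)%N) -> P T -> P (m |: T)) ->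
  forall T, P T.
Proof.
move=> rho_inj P0 PU T; move: {2}#|T| (erefl #|T|) => n.
elim: n T => [|n IHn] T cardT; first by move/cards0_eq: cardT => ->.
have T0 : T != set0 by rewrite -card_gt0 cardT.
have [m mT max_m] := rank_max rho T0.
rewrite -(setD1K mT); apply: PU.
- by rewrite in_setD1 eqxx.
- move=> i /setD1P[neq_im iT].
  by rewrite ltn_neqAle max_m // (inj_eq rho_inj) neq_im.
- by apply: IHn; move: cardT; rewrite (cardsD1 m) mT => -[].
Qed.

Section Chains.
Variables (I : finType) (a : I -> nat) (rho : I -> nat).
Hypothesis rho_inj : injective rho.
Implicit Types (T : {set I}).
Local Notation S := (prefix_sum a rho).

Lemma prefix_sumU1 T (m i : I) : m \notin T ->
  (forall j, j \in T -> (rho j < rho m)%N) -> i \in T -> S (m |: T) i = S T i.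
Proof.
move=> mT max_m iT; rewrite -[in RHS](setU1K mT) prefix_sumD1 ?setU11 //.
exact/ltnW/max_m.
Qed.

Lemma prefix_sumU1_max T (m : I) : m \notin T ->
  (forall j, j \in T -> (rho j < rho m)%N) -> S (m |: T) m = (\sum_(k in T) a k)%N.
Proof.
move=> mT max_m; rewrite prefix_sum_max ?setU11 ?setU1K //.
by move=> i; case/setU1P => [->//|/max_m/ltnW].
Qed.

(** In a chain each interval starts where the previous one ends; the product form
    needs no division. *)
Lemma chain_telescope (R : comNzRingType) (f : nat -> R) T :
  \prod_(i in T) f (S T i) * f (\sum_(k in T) a k)%N
  = \prod_(i in T) f (S T i + a i)%N * f 0%N.
Proof.
move: T; apply: (rank_ind rho_inj) => [|T m mT max_m IH]; first by rewrite !big_set0.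
rewrite !(big_setU1 _ mT) /= prefix_sumU1_max //.
rewrite (eq_bigr (fun i => f (S T i))) => [|i iT]; last by rewrite prefix_sumU1.
rewrite [in RHS](eq_bigr (fun i => f (S T i + a i)%N)) => [|i iT]; last first.
  by rewrite prefix_sumU1.
by rewrite [f _ * _]mulrC IH [(a m + _)%N]addnC mulrC mulrA.
Qed.

Lemma chain_tiling (R : comNzRingType) (h : nat -> R) T :
  \prod_(i in T) \prod_(k < a i) h (S T i + k)%N
  = \prod_(k < \sum_(k in T) a k) h k.
Proof.
move: T; apply: (rank_ind rho_inj) => [|T m mT max_m IH].
  by rewrite !big_set0 big_ord0.
rewrite !(big_setU1 _ mT) /= prefix_sumU1_max // addnC big_split_ord /= -IH.
rewrite mulrC; congr (_ * _).
by apply: eq_bigr => i iT; rewrite prefix_sumU1.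
Qed.

End Chains.

(** * The q-Dyson product with respect to a ranking *)

(** The factor of the pair (x, y), with x before y, once the denominators
    y^b x^c have been cleared. *)
Definition pair_factor (R : comNzRingType) (q x y : R) (b c : nat) : R :=
  \prod_(k < b) (y - q ^+ k * x) * \prod_(k < c) (x - q ^+ k.+1 * y).

Definition dyson_prod (R : comNzRingType) (q : R) (I : finType)
    (a rho : I -> nat) (T : {set I}) (x : I -> R) : R :=
  \prod_(i in T) \prod_(j in T | (rho i < rho j)%N)
    pair_factor q (x i) (x j) (a i) (a j).

(** The quasi-symmetry of the q-Dyson product: multiplying a variable by q moves
    it from the first to the last place of the order. *)
Lemma pair_factor_shift (R : comNzRingType) (q x y : R) (b c : nat) :
  pair_factor q (q * x) y b c = q ^+ c * pair_factor q y x c b.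
Proof.
rewrite /pair_factor mulrA mulrC; congr (_ * _).
  rewrite -[X in _ ^+ X](card_ord c) -prodr_const -big_split /=.
  by apply: eq_bigr => k _; rewrite exprS; ring.
by apply: eq_bigr => k _; rewrite exprS; ring.
Qed.

Section DysonProd.
Variables (R : comNzRingType) (q : R) (I : finType) (a : I -> nat).
Implicit Types (rho : I -> nat) (T : {set I}) (x : I -> R).

Lemma eq_dyson_prod_rank rho rho' T x :
  {in T &, forall i j, (rho i < rho j)%N = (rho' i < rho' j)%N} ->
  dyson_prod q a rho T x = dyson_prod q a rho' T x.
Proof.
move=> eq_rho; apply: eq_bigr => i iT; apply: eq_bigl => j.
by case: (boolP (j \in T)) => //= jT; rewrite eq_rho.
Qed.

Lemma eq_dyson_prod rho T x x' : {in T, x =1 x'} ->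
  dyson_prod q a rho T x = dyson_prod q a rho T x'.
Proof.
move=> eq_x; apply: eq_bigr => i iT; apply: eq_bigr => j /andP[jT _].
by rewrite !eq_x.
Qed.

Lemma dyson_prodU1 rho T x z : injective rho -> z \notin T ->
  dyson_prod q a rho (z |: T) x =
  dyson_prod q a rho T x *
  \prod_(i in T) (if (rho i < rho z)%N
                  then pair_factor q (x i) (x z) (a i) (a z)
                  else pair_factor q (x z) (x i) (a z) (a i)).
Proof.
move=> rho_inj zT; rewrite /dyson_prod big_setU1 //=.
rewrite big_mkcondr big_setU1 //= ltnn mul1r.
rewrite [X in _ * X](eq_bigr (fun i =>
  \prod_(j in T | (rho i < rho j)%N) pair_factor q (x i) (x j) (a i) (a j) *
  (if (rho i < rho z)%N then pair_factor q (x i) (x z) (a i) (a z) else 1))).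
  rewrite big_split /= mulrCA; congr (_ * _); rewrite -big_split /=.
  apply: eq_bigr => i iT; case: ltngtP => [||/rho_inj eq_zi].
  - by rewrite mulr1.
  - by rewrite mul1r.
  - by rewrite eq_zi iT in zT.
by move=> i iT; rewrite big_mkcondr big_setU1 //= -big_mkcondr mulrC.
Qed.

End DysonProd.

(** If the two intervals overlap or touch in the wrong order, the exponent
    difference is one of those listed in the factor. *)
Lemma pair_factor_neq0 (R : comNzRingType) (q : R) (u v b c : nat) :
  pair_factor q (q ^+ u) (q ^+ v) b c != 0 -> (u + b <= v)%N || (v + c < u)%N.
Proof.
apply: contraNT; rewrite negb_or -leqNgt -ltnNge => /andP[lt_v le_u].
apply/eqP; rewrite /pair_factor; have [le_uv|lt_vu] := leqP u v.
  have lt_b : (v - u < b)%N by lia.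
  by rewrite (bigD1 (Ordinal lt_b)) //= -exprD subnK // subrr !mul0r.
have lt_c : (u - v.+1 < c)%N by lia.
rewrite mulrC (bigD1 (Ordinal lt_c)) //= -exprD addSn -addnS subnK //.
by rewrite subrr !mul0r.
Qed.

Lemma packed_of_neq0 (R : idomainType) (q : R) (I : finType) (a rho alpha : I -> nat)
    (T : {set I}) :
  dyson_prod q a rho T (fun i => q ^+ alpha i) != 0 -> packed a rho T alpha.
Proof.
move=> /prodf_neq0 nz i j iT jT lt_ij; apply: (@pair_factor_neq0 _ q).
by move: (nz i iT) => /prodf_neq0; apply; rewrite jT lt_ij.
Qed.

Section MoveLast.
Variables (R : comNzRingType) (q : R) (I : finType) (a : I -> nat).
Implicit Types (rho : I -> nat) (x : I -> R).

Lemma dyson_prod_rank_last rho x z : injective rho ->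
  dyson_prod q a (rank_last z rho) setT x =
  dyson_prod q a rho [set~ z] x *
  \prod_(i in [set~ z]) pair_factor q (x i) (x z) (a i) (a z).
Proof.
move=> rho_inj.
have zT : z \notin [set~ z] by rewrite !inE eqxx.
rewrite -[X in dyson_prod _ _ _ X _ = _](setUCr [set z]).
rewrite dyson_prodU1 //; last exact: rank_last_inj.
congr (_ * _).
  apply: eq_dyson_prod_rank => i j; rewrite !inE /rank_last.
  by move=> /negPf-> /negPf->.
by apply: eq_bigr => i; rewrite !inE => /rank_last_lt->.
Qed.

(** The pairs in which z is the first element are turned over by
    [pair_factor_shift]; in the remaining ones the new value of x z stays. *)
Lemma dyson_prod_shift rho x x' z : injective rho ->
  x' z = q * x z -> (forall i, i != z -> x' i = x i) ->
  dyson_prod q a rho setT x' =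
  q ^+ (\sum_(i | (rho z < rho i)%N) a i) *
  (dyson_prod q a rho [set~ z] x *
   \prod_(i in [set~ z])
     pair_factor q (x i) (if (rho i < rho z)%N then x' z else x z) (a i) (a z)).
Proof.
move=> rho_inj x'z x'E.
have zT : z \notin [set~ z] by rewrite !inE eqxx.
rewrite -[X in dyson_prod _ _ _ X _ = _](setUCr [set z]) dyson_prodU1 //.
rewrite mulrCA; congr (_ * _).
  by apply: eq_dyson_prod => i; rewrite !inE => /x'E.
have -> : q ^+ (\sum_(i | (rho z < rho i)%N) a i) =
    \prod_(i in [set~ z]) (if (rho z < rho i)%N then q ^+ a i else 1).
  rewrite expr_sum -big_mkcondr /=; apply: eq_bigl => i; rewrite !inE.
  by case: eqVneq => [->|//]; rewrite ltnn.
rewrite -big_split /=; apply: eq_bigr => i; rewrite !inE => neq_iz.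
rewrite x'E //; case: ltngtP => [||/rho_inj eq_iz]; first by rewrite mul1r.
  by rewrite x'z pair_factor_shift.
by rewrite eq_iz eqxx in neq_iz.
Qed.

(** For x z = 0 the shifted point is the point itself, so the place of z in the
    order affects the product only by a power of q. *)
Lemma dyson_prod_zero rho x z : injective rho -> x z = 0 ->
  dyson_prod q a rho setT x =
  q ^+ (\sum_(i | (rho z < rho i)%N) a i) *
  dyson_prod q a (rank_last z rho) setT x.
Proof.
move=> rho_inj xz0; rewrite (@dyson_prod_shift rho x x z) ?xz0 ?mulr0 //.
rewrite dyson_prod_rank_last //; congr (_ * (_ * _)).
by apply: eq_bigr => i _; rewrite if_same xz0.
Qed.

Lemma rmorph_pair_factor (R' : comNzRingType) (f : {rmorphism R -> R'})
    (x y : R) (b c : nat) :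
  f (pair_factor q x y b c) = pair_factor (f q) (f x) (f y) b c.
Proof.
rewrite rmorphM !rmorph_prod; congr (_ * _); apply: eq_bigr => k _;
  by rewrite rmorphB rmorphM rmorphXn.
Qed.

Lemma rmorph_dyson_prod (R' : comNzRingType) (f : {rmorphism R -> R'})
    rho (T : {set I}) x :
  f (dyson_prod q a rho T x) = dyson_prod (f q) a rho T (fun i => f (x i)).
Proof.
rewrite rmorph_prod; apply: eq_bigr => i _; rewrite rmorph_prod.
by apply: eq_bigr => j _; rewrite rmorph_pair_factor.
Qed.

End MoveLast.

(** When y = q^D is multiplied by q all but the extreme factors of the pair are
    shifted into each other. *)
Lemma pair_factor_top_shift (R : comNzRingType) (q : R) (D b c : nat) :
  (b <= D)%N ->
  pair_factor q 1 (q ^+ D.+1) b c * (1 - q ^+ (D.+1 - b)) =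
  pair_factor q 1 (q ^+ D) b c * (1 - q ^+ (D.+1 + c)).
Proof.
move=> le_bD; rewrite /pair_factor.
have -> : \prod_(k < b) (q ^+ D - q ^+ k * 1) * \prod_(k < c) (1 - q ^+ k.+1 * q ^+ D)
    * (1 - q ^+ (D.+1 + c)) =
    \prod_(k < b) (q ^+ D - q ^+ k * 1) * (1 - q ^+ D.+1) *
    \prod_(k < c) (1 - q ^+ k.+1 * q ^+ D.+1).
  rewrite -!mulrA; congr (_ * _); elim: c => [|c IHc].
    by rewrite !big_ord0 mul1r mulr1 addn0.
  rewrite [in LHS]big_ord_recr [in RHS]big_ord_recr /= [RHS]mulrA -IHc -!exprD.
  have -> : (c.+1 + D = D.+1 + c)%N by lia.
  by rewrite [(c.+1 + _)%N]addnC; ring.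
rewrite mulrAC; congr (_ * _); elim: b le_bD => [|b IHb] lt_bD.
  by rewrite !big_ord0 subn0 !mul1r.
rewrite !big_ord_recr /= [RHS]mulrAC -IHb; last exact: ltnW.
rewrite subSS subSn ?(ltnW lt_bD) //.
have := subnK (ltnW lt_bD); move: (D - b)%N => e <-.
by rewrite !exprS !exprD; ring.
Qed.

(** * The value of the q-Dyson product along a chain *)

(** The derivative at q^c of the monic polynomial with roots 1, q, ..., q^D. *)
Definition node_prod (R : comNzRingType) (q : R) (D c : nat) : R :=
  \prod_(l < D.+1 | l != c :> nat) (q ^+ c - q ^+ l).

Section Nodes.
Variables (R : comNzRingType) (q : R).

Lemma node_prodS D c : (c <= D)%N ->
  node_prod q D.+1 c = node_prod q D c * (q ^+ c - q ^+ D.+1).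
Proof.
move=> le_cD; rewrite /node_prod big_mkcond big_ord_recr /= -big_mkcond.
by rewrite (gtn_eqF (_ : c < D.+1)%N).
Qed.

Lemma node_prod_add D b c : (c <= D)%N ->
  node_prod q (D + b) c = node_prod q D c * \prod_(k < b) (q ^+ c - q ^+ (D + k).+1).
Proof.
move=> le_cD; elim: b => [|b IHb]; first by rewrite addn0 big_ord0 mulr1.
rewrite addnS node_prodS; last by rewrite (leq_trans le_cD) ?leq_addr.
by rewrite IHb big_ord_recr /= mulrA.
Qed.

Lemma node_prod_top D : node_prod q D D = \prod_(k < D) (q ^+ D - q ^+ k).
Proof.
rewrite /node_prod big_mkcond big_ord_recr /= eqxx mulr1 -big_mkcond /=.
by apply: eq_bigl => k; rewrite ltn_eqF.
Qed.

Lemma node_prod_topS D :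
  node_prod q D.+1 D.+1 = (q ^+ D.+1 - 1) * q ^+ D * node_prod q D D.
Proof.
rewrite !node_prod_top big_ord_recl expr0 -mulrA; congr (_ * _).
rewrite -[X in q ^+ X * _](card_ord D) -prodr_const -big_split /=.
by apply: eq_bigr => k _; rewrite /bump /= add1n !exprS mulrBr.
Qed.

Lemma qpochD (z : R) m b :
  qpoch q z (m + b) = qpoch q z m * qpoch q (z * q ^+ m) b.
Proof.
rewrite /qpoch big_split_ord /=; congr (_ * _).
by apply: eq_bigr => k _; rewrite exprD mulrA.
Qed.

(** When an index m is added at the end of the chain, the first halves of the new
    pair factors tile the range of nodes below the new point and cancel against
    its own derivative.  The second halves, together with the growth of the other
    derivatives, telescope to a q-binomial coefficient. *)
Theorem dyson_prod_chain (I : finType) (a rho : I -> nat) (T : {set I}) :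
  injective rho ->
  dyson_prod q a rho T (fun i => q ^+ prefix_sum a rho T i) *
    \prod_(i in T) qpoch q q (a i) =
  qpoch q q (\sum_(i in T) a i) *
    \prod_(i in T) node_prod q (\sum_(k in T :\ i) a k) (prefix_sum a rho T i).
Proof.
move=> rho_inj; move: T; apply: (rank_ind rho_inj) => [|T m mT max_m IH].
  by rewrite /dyson_prod !big_set0 /qpoch big_ord0.
set s := (\sum_(i in T) a i)%N; set b := a m.
have s_le i : i \in T -> (prefix_sum a rho T i + a i <= s)%N.
  by move=> iT; rewrite /s (big_setD1 i) //= addnC leq_add2l prefix_sum_le.
have sD i : i \in T -> s = (a i + \sum_(k in T :\ i) a k)%N.
  by move=> iT; rewrite /s (big_setD1 i).
rewrite dyson_prodU1 // !big_setU1 //= prefix_sumU1_max // -/s setU1K //.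
rewrite (@eq_dyson_prod _ _ _ _ _ _ _ (fun i => q ^+ prefix_sum a rho T i)) => [|i
  iT]; last first.
  by rewrite prefix_sumU1.
rewrite (eq_bigr (fun i => \prod_(k < a i) (q ^+ s - q ^+ (prefix_sum a rho T i +
  k)) *
   (q ^+ prefix_sum a rho T i) ^+ b *
   \prod_(k < b) (1 - q ^+ (k.+1 + s - prefix_sum a rho T i)))) => [|i iT];
     last first.
  rewrite max_m // prefix_sumU1 // /pair_factor -mulrA; congr (_ * _).
    by apply: eq_bigr => k _; rewrite exprD mulrC.
  rewrite -[X in _ ^+ X * _](card_ord b) -prodr_const -big_split /=.
  apply: eq_bigr => k _; rewrite mulrBr mulr1 -!exprD; congr (_ - _ ^+ _).
  by rewrite subnKC // (leq_trans (leq_trans (leq_addr _ _) (s_le i iT))) ?leq_addl.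
rewrite [X in _ = _ * (_ * X)](eq_bigr (fun i =>
   node_prod q (\sum_(k in T :\ i) a k) (prefix_sum a rho T i) *
   ((q ^+ prefix_sum a rho T i) ^+ b *
   \prod_(k < b) (1 - q ^+ (k.+1 + s - (prefix_sum a rho T i + a i)))))) => [|i
     iT]; last first.
  rewrite prefix_sumU1 //.
  have mi : m != i by apply: contraTneq iT => <-.
  have -> : (m |: T) :\ i = m |: (T :\ i).
    by apply/setP => k; rewrite !inE; case: (eqVneq k i) => // ->;
      rewrite eq_sym (negPf mi).
  rewrite big_setU1 ?in_setD1 ?(negPf mT) ?andbF //= addnC node_prod_add; last first.
    by move: (s_le i iT); rewrite (sD i iT); lia.
  congr (_ * _).
  rewrite -[X in _ ^+ X * _](card_ord b) -prodr_const -big_split /=.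
  apply: eq_bigr => k _; rewrite mulrBr mulr1 -!exprD; congr (_ - _ ^+ _).
  move: (prefix_sum a rho T i) (s_le i iT) => u; rewrite (sD i iT).
  by move: (a i) (\sum_(j in T :\ i) a j)%N (nat_of_ord k) => c v l; clear; lia.
(* f (prefix sum) comes from the pair factor, f (prefix sum + a i) from the nodes
   added to the grid of x_i *)
pose f u := \prod_(k < b) (1 - q ^+ (k.+1 + s - u)).
have tele := chain_telescope a rho_inj f T.
have tile := chain_tiling a rho_inj (fun u => q ^+ s - q ^+ u) T.
rewrite !big_split /= -/b.
rewrite tile -node_prod_top.
have fs : f s = qpoch q q b.
  by apply: eq_bigr => k _; rewrite addnK exprS.
have f0 : qpoch q q (b + s) = qpoch q q s * f 0%N.
  rewrite addnC qpochD; congr (_ * _); apply: eq_bigr => k _.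
  by rewrite subn0 -exprS -exprD addnC addSn addnS addnC.
rewrite -fs f0.
set X1 := \prod_(i in T) f _ in tele; set X2 := \prod_(i in T) f _ in tele.
rewrite -/X1 -/X2; rewrite -/s in IH; move: IH tele.
move: (qpoch q q s) (f s) (f 0%N) X1 X2 => qs fs' f0' X1 X2.
move: (dyson_prod _ _ _ _ _) (\prod_(i in T) qpoch q q (a i)) (node_prod q s s).
move: (\prod_(i in T) node_prod _ _ _) (\prod_(i in T) _ ^+ b) => N E P Q W.
move=> IH tele; transitivity ((P * Q) * (W * E) * (X1 * fs')); first by ring.
by rewrite IH tele; ring.
Qed.
End Nodes.

Section QGeneric.
Variables (K : fieldType) (q : K).
Hypothesis q_inj : injective (fun k : nat => q ^+ k).

Lemma qX_neq1 k : (0 < k)%N -> 1 - q ^+ k != 0.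
Proof.
by case: k => // k _; rewrite subr_eq0 -(expr0 q); apply/eqP => /q_inj.
Qed.

Lemma qX_neq0 k : q ^+ k != 0.
Proof.
have q0 : q != 0.
  by apply/eqP => q0; have /(_ 1%N 2%N) := q_inj; rewrite q0 !expr0n => /(_ erefl).
exact: expf_neq0.
Qed.

Lemma qXS_neq1 k : q ^+ k.+1 - 1 != 0.
Proof. by rewrite -oppr_eq0 opprB qX_neq1. Qed.

Lemma qSX_neq1 k : 1 - q ^+ k.+1 != 0.
Proof. exact: qX_neq1. Qed.

Lemma node_prod_neq0 D c : node_prod q D c != 0.
Proof.
apply/prodf_neq0 => l neq_lc; rewrite subr_eq0; apply/eqP => /q_inj eq_cl.
by rewrite eq_cl eqxx in neq_lc.
Qed.

Lemma qpoch_neq0 k : qpoch q q k != 0.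
Proof. by apply/prodf_neq0 => i _; rewrite -exprS qX_neq1. Qed.

Definition qmultinomial (I : finType) (a : I -> nat) : K :=
  qpoch q q (\sum_i a i) / \prod_i qpoch q q (a i).

Lemma dyson_prod_chain_value (I : finType) (a rho : I -> nat) : injective rho ->
  dyson_prod q a rho setT (fun i => q ^+ prefix_sum a rho setT i) =
  qmultinomial a *
  \prod_i node_prod q (\sum_(k in [set~ i]) a k) (prefix_sum a rho setT i).
Proof.
move=> rho_inj; have := dyson_prod_chain q a setT rho_inj.
have nz : \prod_i qpoch q q (a i) != 0.
  by apply/prodf_neq0 => i _; apply: qpoch_neq0.
have setTE (f : I -> K) : \prod_(i in setT) f i = \prod_i f i.
  by apply: eq_bigl => i; rewrite inE.
rewrite !setTE => /(canRL (mulfK nz)) ->; rewrite /qmultinomial mulrAC.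
congr (_ / _ * _); first by congr qpoch; apply: eq_bigl => i; rewrite inE.
by apply: eq_bigr => i _; rewrite setTD.
Qed.
End QGeneric.

(** * Degrees and the target monomial *)

(** Each ordered pair of distinct indices occurs once, on one of the two sides of
    the ranking. *)
Lemma big_ranked_pairs (V : Type) (idx : V) (op : Monoid.com_law idx)
    (I : finType) (rho : I -> nat) (h : I -> I -> V) : injective rho ->
  \big[op/idx]_i \big[op/idx]_(j | (rho i < rho j)%N) op (h i j) (h j i) =
  \big[op/idx]_i \big[op/idx]_(j in [set~ i]) h i j.
Proof.
move=> rho_inj; under eq_bigr do rewrite big_split /=.
rewrite big_split /= [X in op _ X](exchange_big_dep predT) //= -big_split /=.
apply: eq_bigr => i _; rewrite [RHS](bigID (fun j => rho i < rho j)%N) /=.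
congr (op _ _); apply: eq_bigl => j; rewrite !inE;
  case: (eqVneq j i) => [->|neq_ji]; rewrite ?ltnn //=.
by rewrite -leqNgt ltn_neqAle (inj_eq rho_inj) neq_ji.
Qed.

Lemma dyson_prodT (R : comNzRingType) (q : R) (I : finType) (a rho : I -> nat)
    (x : I -> R) :
  dyson_prod q a rho setT x =
  \prod_i \prod_(j | (rho i < rho j)%N) pair_factor q (x i) (x j) (a i) (a j).
Proof.
apply: eq_big => [i|i _]; first by rewrite inE.
by apply: eq_bigl => j; rewrite inE.
Qed.

Definition dyson_poly (R : comNzRingType) (q : R) (N : nat)
    (a rho : 'I_N -> nat) : {mpoly R[N]} :=
  dyson_prod q%:MP a rho setT (fun i => 'X_i).

Section Degree.
Variables (R : idomainType) (N : nat).
Implicit Types p : {mpoly R[N]}.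

Lemma msizeM_leS p1 p2 d1 d2 : (msize p1 <= d1.+1)%N -> (msize p2 <= d2.+1)%N ->
  (msize (p1 * p2) <= (d1 + d2).+1)%N.
Proof.
move=> le1 le2; have [->|nz1] := eqVneq p1 0; first by rewrite mul0r msize0.
have [->|nz2] := eqVneq p2 0; first by rewrite mulr0 msize0.
by rewrite msizeM //; lia.
Qed.

Lemma msize_prod_leS (J : Type) (s : seq J) (P : pred J) (F : J -> {mpoly R[N]})
    (d : J -> nat) :
  (forall j, P j -> msize (F j) <= (d j).+1)%N ->
  (msize (\prod_(j <- s | P j) F j) <= (\sum_(j <- s | P j) d j).+1)%N.
Proof.
move=> leF; apply: (big_ind2 (fun p e => msize p <= e.+1)%N) => //.
  by rewrite msize1.
by move=> *; apply: msizeM_leS.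
Qed.

Lemma msize_XsubX_le (i j : 'I_N) (c : R) :
  (msize ('X_i - c%:MP * 'X_j : {mpoly R[N]}) <= 2)%N.
Proof.
apply: leq_trans (msizeD_le _ _) _; rewrite geq_max msizeX mdeg1 leqnn /=.
by rewrite msizeN mul_mpolyC (leq_trans (msizeZ_le _ _)) // msizeX mdeg1.
Qed.

Lemma msize_dyson_prod (q : R) (a rho : 'I_N -> nat) : injective rho ->
  (msize (dyson_poly q a rho) <= (\sum_i \sum_(j in [set~ i]) a j).+1)%N.
Proof.
move=> rho_inj.
rewrite /dyson_poly -(big_ranked_pairs _ (fun i j => a j) rho_inj) /=.
rewrite dyson_prodT; apply: msize_prod_leS => i _.
apply: msize_prod_leS => j _; rewrite addnC /pair_factor.
by apply: msizeM_leS; rewrite -[X in (_ <= X.+1)%N]card_ord -sum1_card;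
  apply: msize_prod_leS => k _; rewrite -rmorphXn msize_XsubX_le.
Qed.
End Degree.

Section Coefficient.
Variables (K : fieldType) (n : nat) (a : 'I_n.+1 -> nat) (r s t : 'I_n.+1).
Local Notation d i := (\sum_(k in [set~ i]) a k)%N.

(** The exponents of the monomial whose coefficient in x_r x_s F is the constant
    term of x_r x_s / (x_0 x_t) times the q-Dyson product. *)
Definition target : 'X_{1..n.+1} :=
  [multinom (d i + (i == ord0) + (i == t))%N | i < n.+1].

Lemma mdeg_target : mdeg target = (\sum_i d i).+2.
Proof.
have sum1 (c : 'I_n.+1) : (\sum_i (i == c) = 1)%N.
  by rewrite (bigD1 c) //= eqxx big1 // => i /negPf->.
rewrite mdegE; under eq_bigr do rewrite mnmE.
by rewrite !big_split /= !sum1 !addn1.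
Qed.

(** The two polynomials differ by terms of degree smaller than that of the target
    monomial. *)
Lemma mcoeff_target_shift (G : {mpoly K[n.+1]}) (u v : K) :
  (msize G <= (\sum_i d i).+1)%N ->
  ('X_r * 'X_s * G)@_target =
  (('X_r - u%:MP) * ('X_s - v%:MP) * G)@_target.
Proof.
move=> szG; apply/eqP; rewrite -subr_eq0 -mcoeffB; apply/eqP.
have -> : 'X_r * 'X_s * G - ('X_r - u%:MP) * ('X_s - v%:MP) * G =
    (v%:MP * 'X_r + u%:MP * ('X_s - v%:MP)) * G by ring.
have szX i : (msize ('X_i : {mpoly K[n.+1]}) <= 2)%N by rewrite msizeX mdeg1.
apply/eqP; rewrite mcoeff_eq0; apply: msize_mdeg_ge; rewrite mdeg_target.
rewrite -[X in (_ <= X.+1)%N]add1n; apply: msizeM_leS => //.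
apply: leq_trans (msizeD_le _ _) _; rewrite !mul_mpolyC geq_max.
rewrite !(leq_trans (msizeZ_le _ _)) // (leq_trans (msizeD_le _ _)) //.
by rewrite msizeN geq_max szX msizeC; case: (_ == _).
Qed.

Lemma msize_target_shift (G : {mpoly K[n.+1]}) (u v : K) :
  (msize G <= (\sum_i d i).+1)%N ->
  (msize (('X_r - u%:MP) * ('X_s - v%:MP) * G) <= (mdeg target).+1)%N.
Proof.
move=> szG; rewrite mdeg_target.
have szX i c : (msize ('X_i - c%:MP : {mpoly K[n.+1]}) <= 2)%N.
  rewrite (leq_trans (msizeD_le _ _)) // msizeN geq_max msizeX mdeg1 leqnn.
  by rewrite msizeC; case: (_ == _).
rewrite -[X in (_ <= X.+1)%N](add2n (\sum_i d i)%N).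
apply: msizeM_leS => //; exact: (@msizeM_leS _ _ _ _ 1 1).
Qed.
End Coefficient.

(** * The coefficient for two rankings *)

(** The order 0, t, 1, 2, ... with t taken out of its natural place; doubling
    the ranks frees the value 1 for t. *)
Definition rank_front (n : nat) (t i : 'I_n.+1) : nat := if i == t then 1%N else i.*2.

Section Points.
Variables (K : fieldType) (q : K) (n : nat) (a : 'I_n.+1 -> nat).
Variables (r s t : 'I_n.+1).
Hypothesis q_inj : injective (fun k : nat => q ^+ k).
Hypotheses (t0 : t != ord0) (r0 : r != ord0) (s0 : s != ord0).
Hypotheses (neq_tr : t != r) (lt_rs : (r < s)%N) (lt_ts : (t < s)%N).

Local Notation d i := (\sum_(k in [set~ i]) a k)%N.
Local Notation m := (target a t).
Local Notation F rho := (dyson_poly q a rho).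
Local Notation natural := (@nat_of_ord n.+1).
Local Notation front := (rank_front t).
Local Notation between i := (prefix_sum a natural (setT :\ t :\ ord0) i).
Local Notation a0 := (a ord0).
Local Notation rest := (\sum_(k in setT :\ t :\ ord0) a k)%N.

Lemma t_gt0 : (0 < t)%N.
Proof. by rewrite lt0n; exact: t0. Qed.

Lemma neq_st : s != t.
Proof. by rewrite -val_eqE gtn_eqF. Qed.

Lemma neq_rt : r != t.
Proof. by rewrite eq_sym. Qed.

Lemma natural_inj : injective natural.
Proof. exact: val_inj. Qed.

Lemma front_inj : injective front.
Proof.
move=> i j; rewrite /rank_front; case: eqP => [->|_]; case: eqP => [->|_] //.
- by move=> /(congr1 odd); rewrite odd_double.
- by move=> /(congr1 odd); rewrite odd_double.
- by move=> /double_inj/val_inj.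
Qed.

Lemma front_first i : i != ord0 -> (front ord0 < front i)%N.
Proof.
rewrite /rank_front [ord0 == t]eq_sym (negPf t0) -lt0n => i0.
by case: eqP => // _; rewrite double_gt0.
Qed.

Lemma front_second i : i != ord0 -> i != t -> (front t < front i)%N.
Proof.
rewrite /rank_front eqxx -val_eqE /= -lt0n => i0 /negPf->.
by rewrite -addnn; lia.
Qed.

Lemma natural_first i : i != ord0 -> (natural ord0 < natural i)%N.
Proof. by rewrite -val_eqE /= -lt0n. Qed.

Lemma between_front i : i != t ->
  prefix_sum a front (setT :\ t :\ ord0) i = between i.
Proof.
move=> neq_it; apply: eq_bigl => k; rewrite !in_setD1 /rank_front (negPf neq_it).
by case: (eqVneq k t) => [|_]; rewrite ?andbF // ltn_double.
Qed.

Lemma prefix_sum_first_two rho i :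
  i != ord0 -> i != t -> (rho ord0 < rho i)%N -> (rho t < rho i)%N ->
  [/\ prefix_sum a rho setT i =
        (a0 + a t + prefix_sum a rho (setT :\ t :\ ord0) i)%N,
      prefix_sum a rho (setT :\ ord0) i =
        (a t + prefix_sum a rho (setT :\ t :\ ord0) i)%N
    & prefix_sum a rho (setT :\ t) i =
        (a0 + prefix_sum a rho (setT :\ t :\ ord0) i)%N].
Proof.
move=> i0 it lt0 ltt.
have swap : setT :\ t :\ ord0 = setT :\ ord0 :\ t :> {set 'I_n.+1}.
  by apply/setP => k; rewrite !inE andbCA.
rewrite (prefix_sumD1_before a (in_setT ord0) lt0) -addnA.
split.
- by rewrite swap (@prefix_sumD1_before _ a rho (setT :\ ord0) t) // !inE t0.
- by rewrite swap (@prefix_sumD1_before _ a rho (setT :\ ord0) t) // !inE t0.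
by rewrite (@prefix_sumD1_before _ a rho (setT :\ t) ord0) // !inE eq_sym t0.
Qed.

Lemma target_le i l : (l <= d i)%N -> (l <= m i)%N.
Proof. by move=> le_l; rewrite mnmE -addnA (leq_trans le_l) ?leq_addr. Qed.

Lemma target_first : m ord0 = (d ord0).+1.
Proof. by rewrite mnmE eqxx eq_sym (negPf t0) addn0 addn1. Qed.

Lemma target_second : m t = (d t).+1.
Proof. by rewrite mnmE eqxx (negPf t0) addn0 addn1. Qed.

Lemma target_other i : i != ord0 -> i != t -> m i = d i.
Proof. by move=> /negPf i0 /negPf it; rewrite mnmE i0 it !addn0. Qed.

Lemma meval_F rho (x : 'I_n.+1 -> K) :
  (F rho).@[x] = dyson_prod q a rho setT x.
Proof.
rewrite /dyson_poly rmorph_dyson_prod /= mevalC.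
by apply: eq_dyson_prod => i _; rewrite mevalXU.
Qed.

Lemma meval_shifted u v (G : {mpoly K[n.+1]}) (x : 'I_n.+1 -> K) :
  (('X_r - u%:MP) * ('X_s - v%:MP) * G).@[x] = (x r - u) * (x s - v) * G.@[x].
Proof. by rewrite !mevalM !mevalB !mevalXU !mevalC. Qed.

(** The point at which 0 has moved to the far end, with the extra node
    q^(d_0 + 1); [point_second] is the one for t. *)
Definition point_first i :=
  if i == ord0 then (d ord0).+1 else prefix_sum a front (setT :\ ord0) i.
Definition point_second i :=
  if i == t then (d t).+1 else prefix_sum a front (setT :\ t) i.

Lemma node_prod_split (D alpha : 'I_n.+1 -> nat) :
  \prod_i node_prod q (D i) (alpha i) =
  node_prod q (D ord0) (alpha ord0) * (node_prod q (D t) (alpha t) *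
  \prod_(i | (i != ord0) && (i != t)) node_prod q (D i) (alpha i)).
Proof. by rewrite (bigD1 ord0) //= (bigD1 t) //=. Qed.

Lemma room_second : d t = (a0 + rest)%N.
Proof.
by rewrite -setTD (big_setD1 ord0) // !inE eq_sym t0.
Qed.

Lemma room_first : d ord0 = (a t + rest)%N.
Proof.
rewrite -setTD (big_setD1 t) /=; last by rewrite in_setD1 t0 inE.
by congr (_ + _)%N; apply: eq_bigl => k; rewrite !inE andbCA.
Qed.

Lemma point_first_second : point_first t = 0%N.
Proof.
rewrite /point_first (negPf t0) /prefix_sum big1 // => k; rewrite !inE andbT.
case/andP => k0; rewrite ltnNge; have [->|kt] := eqVneq k t; rewrite ?leqnn //.
by rewrite ltnW ?front_second.
Qed.

Lemma point_second_first : point_second ord0 = 0%N.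
Proof.
rewrite /point_second eq_sym (negPf t0) /prefix_sum big1 // => k; rewrite !inE andbT.
by case/andP => kt; have [->|k0] := eqVneq k ord0;
  rewrite ?ltnn // ltnNge ltnW ?front_first.
Qed.

Lemma point_first_natural : point_first s = prefix_sum a natural (setT :\ ord0) s.
Proof.
rewrite /point_first (negPf s0).
have [||_ -> _] := @prefix_sum_first_two front s s0 neq_st;
  rewrite ?front_first ?front_second ?neq_st //.
have [||_ -> _] := @prefix_sum_first_two natural s s0 neq_st;
  rewrite ?natural_first //.
by rewrite between_front // neq_st.
Qed.

(** By the shift x_0 -> x_0 / q this is the value along the chain in which 0 comes
    last; only the derivatives at x_0 and x_t see the enlarged grid. *)
Lemma dyson_point_first :
  dyson_prod q a front setT (fun i => q ^+ point_first i) /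
    \prod_i node_prod q (m i) (point_first i)
  = qmultinomial q a / ((q ^+ (d ord0).+1 - 1) * (1 - q ^+ (d t).+1)).
Proof.
pose beta := prefix_sum a (rank_last ord0 front) setT.
have last_inj : injective (rank_last ord0 front) := rank_last_inj front_inj.
have beta0 : beta ord0 = d ord0 by rewrite /beta prefix_sum_rank_last_self setTD.
have betaE i : i != ord0 -> beta i = point_first i.
  by move=> i0; rewrite /beta prefix_sum_rank_last // /point_first (negPf i0).
have first_t := point_first_second.
rewrite (@dyson_prod_shift _ _ _ _ _ (fun i => q ^+ beta i) _ ord0 front_inj);
  last first.
- by move=> i i0; rewrite betaE.
- by rewrite beta0 /point_first eqxx exprS.
have -> : (\sum_(i | front ord0 < front i) a i = d ord0)%N.
  apply: eq_bigl => i; rewrite !inE; case: eqVneq => [->|/front_first->//].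
  by rewrite ltnn.
rewrite (eq_bigr (fun i => pair_factor q (q ^+ beta i) (q ^+ beta ord0) (a i) (a
  ord0))); last first.
  by move=> i; rewrite !inE => /front_first lt0; rewrite ltnNge ltnW.
rewrite -dyson_prod_rank_last; last exact: front_inj.
rewrite dyson_prod_chain_value // -/beta.
rewrite !node_prod_split target_first target_second first_t.
have -> : point_first ord0 = (d ord0).+1 by rewrite /point_first eqxx.
rewrite node_prod_topS node_prodS // expr0.
rewrite -/(beta ord0) -/(beta t) beta0 (betaE t) // first_t.
have -> : \prod_(i | (i != ord0) && (i != t)) node_prod q (m i) (point_first i) =
   \prod_(i | (i != ord0) && (i != t)) node_prod q (d i) (beta i).
  by apply: eq_bigr => i /andP[i0 it]; rewrite target_other // betaE.
rewrite room_first room_second.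
have nzq := qX_neq0 q_inj (a t + rest).
have := node_prod_neq0 q_inj (a t + rest) (a t + rest).
have := node_prod_neq0 q_inj (a0 + rest) 0.
have : \prod_(i | (i != ord0) && (i != t)) node_prod q (d i) (beta i) != 0.
  by apply/prodf_neq0 => i _; apply: node_prod_neq0.
move: (\prod_(i | _) _) (node_prod _ _ _) (node_prod _ _ _) => P X Y.
by move=> nzP nzX nzY; field; rewrite ?oppr_eq0 !(qXS_neq1 q_inj) !(qSX_neq1 q_inj)
  nzq nzP nzX nzY.
Qed.

(** As for [dyson_point_first], except that 0 stays before t, so that their pair
    factor changes according to [pair_factor_top_shift]. *)
Lemma dyson_point_second :
  dyson_prod q a front setT (fun i => q ^+ point_second i) /
    \prod_i node_prod q (m i) (point_second i)
  = qmultinomial q a * (1 - q ^+ (a0 + a t + rest).+1) /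
    (q ^+ a0 * (1 - q ^+ rest.+1) * (q ^+ (a0 + rest).+1 - 1) * (1 - q ^+ (a t +
      rest).+1)).
Proof.
pose beta := prefix_sum a (rank_last t front) setT.
have last_inj : injective (rank_last t front) := rank_last_inj front_inj.
have betat : beta t = d t by rewrite /beta prefix_sum_rank_last_self setTD.
have betaE i : i != t -> beta i = point_second i.
  by move=> it; rewrite /beta prefix_sum_rank_last // /point_second (negPf it).
have second_0 := point_second_first.
rewrite (@dyson_prod_shift _ _ _ _ _ (fun i => q ^+ beta i) _ t front_inj);
  last first.
- by move=> i it; rewrite betaE.
- by rewrite betat /point_second eqxx exprS.
have -> : (\sum_(i | front t < front i) a i = rest)%N.
  apply: eq_bigl => i; rewrite !inE andbT.
  have [->|i0] := eqVneq i ord0; first by rewrite ltnNge ltnW // front_first.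
  by have [->|it] := eqVneq i t; rewrite ?ltnn //= front_second.
have -> : point_second t = (d t).+1 by rewrite /point_second eqxx.
have shift0 : pair_factor q (q ^+ beta ord0) (q ^+ (d t).+1) a0 (a t) =
    pair_factor q (q ^+ beta ord0) (q ^+ beta t) a0 (a t) *
    ((1 - q ^+ (a0 + a t + rest).+1) / (1 - q ^+ rest.+1)).
  apply: (mulIf (qX_neq1 q_inj (ltn0Sn rest))).
  rewrite -[RHS]mulrA divfK ?qX_neq1 // betaE 1?eq_sym // second_0 expr0 betat
    room_second.
  have := @pair_factor_top_shift _ q (a0 + rest) a0 (a t) (leq_addr _ _).
  by rewrite -addnS addKn addnS addSn addnAC.
have -> : \prod_(i in [set~ t]) pair_factor q (q ^+ beta i)
      (if (front i < front t)%N then q ^+ (d t).+1 else q ^+ beta t) (a i) (a t) =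
    \prod_(i in [set~ t]) pair_factor q (q ^+ beta i) (q ^+ beta t) (a i) (a t) *
    ((1 - q ^+ (a0 + a t + rest).+1) / (1 - q ^+ rest.+1)).
  have in0 : ord0 \in [set~ t] by rewrite !inE eq_sym t0.
  rewrite (bigD1 ord0) //= front_first // shift0 [in RHS](bigD1 ord0) //= mulrAC.
  congr (_ * _ * _); apply: eq_bigr => i /andP[]; rewrite !inE => it i0.
  by rewrite ltnNge ltnW ?front_second.
rewrite [dyson_prod _ _ _ _ _ * _]mulrA -dyson_prod_rank_last; last exact: front_inj.
rewrite dyson_prod_chain_value // -/beta.
rewrite !node_prod_split target_first target_second second_0.
have -> : point_second t = (d t).+1 by rewrite /point_second eqxx.
rewrite node_prod_topS node_prodS // expr0.
rewrite -/(beta ord0) -/(beta t) betat (betaE ord0) 1?eq_sym // second_0.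
have -> : \prod_(i | (i != ord0) && (i != t)) node_prod q (m i) (point_second i) =
   \prod_(i | (i != ord0) && (i != t)) node_prod q (d i) (beta i).
  by apply: eq_bigr => i /andP[i0 it]; rewrite target_other // betaE.
rewrite room_first room_second.
have nza := qX_neq0 q_inj a0; have nze := qX_neq0 q_inj rest.
have := node_prod_neq0 q_inj (a0 + rest) (a0 + rest).
have := node_prod_neq0 q_inj (a t + rest) 0.
have : \prod_(i | (i != ord0) && (i != t)) node_prod q (d i) (beta i) != 0.
  by apply/prodf_neq0 => i _; apply: node_prod_neq0.
move: (\prod_(i | _) _) (node_prod _ _ _) (node_prod _ _ _) => P X Y.
have := qXS_neq1 q_inj (a0 + rest); have := qSX_neq1 q_inj (a t + rest);
  have := qSX_neq1 q_inj rest.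
rewrite (exprD q a0 rest).
move: (q ^+ rest.+1) (q ^+ (a t + rest).+1) (q ^+ (a0 + rest).+1) => x1 x2 x3.
move=> nz1 nz2 nz3 nzP nzX nzY; field.
by rewrite nza nze nz1 nz2 nz3 nzP nzX nzY.
Qed.

Lemma msize_F rho : injective rho -> (msize (F rho) <= (\sum_i d i).+1)%N.
Proof. exact: msize_dyson_prod. Qed.

Lemma target_bound i : m i = (\sum_(k in setT :\ i) a k + (i == ord0) + (i == t))%N.
Proof. by rewrite mnmE setTD. Qed.

Lemma prefix_setTD1_le rho (z i : 'I_n.+1) :
  (prefix_sum a rho (setT :\ z) i <= d i)%N.
Proof.
apply: leq_trans (prefix_sum_le _ _ _ _) _.
rewrite big_mkcond [X in (_ <= X)%N]big_mkcond /=; apply: leq_sum => k _.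
by rewrite !inE; case: eqP => //= _; case: ifP.
Qed.

(** The two linear factors kill the rigid configuration and the one in which both
    0 and t have moved to the far end. *)
Lemma mcoeff_front :
  ('X_r * 'X_s * F front)@_m =
  (q ^+ point_first r - q ^+ prefix_sum a front setT r) *
  (q ^+ point_first s - q ^+ prefix_sum a front (setT :\ t :\ ord0) s) *
  (qmultinomial q a / ((q ^+ (d ord0).+1 - 1) * (1 - q ^+ (d t).+1))) +
  (q ^+ point_second r - q ^+ prefix_sum a front setT r) *
  (q ^+ point_second s - q ^+ prefix_sum a front (setT :\ t :\ ord0) s) *
  (qmultinomial q a * (1 - q ^+ (a0 + a t + rest).+1) /
    (q ^+ a0 * (1 - q ^+ rest.+1) * (q ^+ (a0 + rest).+1 - 1) * (1 - q ^+ (a t +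
      rest).+1))).
Proof.
have szF := msize_F front_inj.
rewrite (mcoeff_target_shift r s t (q ^+ prefix_sum a front setT r)
  (q ^+ prefix_sum a front (setT :\ t :\ ord0) s) szF).
have szP := msize_target_shift r s t (q ^+ prefix_sum a front setT r)
  (q ^+ prefix_sum a front (setT :\ t :\ ord0) s) szF.
rewrite (@mcoeff_two_points _ _ (fun _ k => q ^+ k) _ _ (fun _ => q_inj) szP
  point_first point_second ord0); first last.
- move=> gamma le_g; rewrite meval_shifted meval_F !mulf_eq0 !negb_or !subr_eq0.
  case/andP => /andP[ne_r ne_s] /packed_of_neq0 pk.
  have := packed_second_slack front_inj (in_setT ord0) (in_setT t) t0 (front_first t0)
    (fun i _ => @front_second i) pk.
  case=> [i _|eqS|[g0 eqS]|[gt eqS]|eqS].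
  + by rewrite -target_bound.
  + by rewrite eqS ?eqxx ?inE in ne_r.
  + left=> i; rewrite /point_first; case: eqVneq => [->|i0];
    first by rewrite g0 setTD.
    by rewrite eqS // !inE i0.
  + right=> i; rewrite /point_second; case: eqVneq => [->|it];
    first by rewrite gt setTD.
    by rewrite eqS // !inE it.
  + by rewrite eqS ?eqxx // in ne_s; rewrite !inE s0 neq_st.
- move=> i; rewrite /point_second mnmE; case: (eqVneq i t) => [->|_].
    by rewrite (negPf t0) addn0 addn1.
  by rewrite addn0 (leq_trans (prefix_setTD1_le _ _ _)) ?leq_addr.
- move=> i; rewrite /point_first mnmE; case: (eqVneq i ord0) => [->|_].
    by rewrite addn1 leq_addr.
  by rewrite addn0 (leq_trans (prefix_setTD1_le _ _ _)) ?leq_addr.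
- by rewrite point_second_first /point_first eqxx.
rewrite /interp_term !meval_shifted !meval_F.
congr (_ + _); rewrite -[LHS]mulrA; congr (_ * _).
  exact: dyson_point_first.
exact: dyson_point_second.
Qed.

(** The extra node of x_t is 0 instead of a power of q. *)
Definition zero_node (i : 'I_n.+1) (k : nat) : K :=
  if (i == t) && (k == (d t).+1) then 0 else q ^+ k.

Lemma zero_node_inj i : injective (zero_node i).
Proof.
rewrite /zero_node => k l; case: eqP => _ /=; last exact: q_inj.
case: eqP => [->|_]; case: eqP => [->|_] //.
- by move=> /esym/eqP; rewrite (negPf (qX_neq0 q_inj _)).
- by move=> /eqP; rewrite (negPf (qX_neq0 q_inj _)).
exact: q_inj.
Qed.

Local Notation skipped := (\sum_(k < n.+1 | 0 < k < t) a k)%N.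

(** Both sides reduce to the product in which t comes last. *)
Lemma dyson_prod_front_zero (x : 'I_n.+1 -> K) : x t = 0 ->
  q ^+ skipped * dyson_prod q a natural setT x = dyson_prod q a front setT x.
Proof.
move=> xt0; rewrite (dyson_prod_zero q a natural_inj xt0).
rewrite (dyson_prod_zero q a front_inj xt0) mulrA -exprD.
congr (_ ^+ _ * _).
  have after k : k != t -> (front t < front k)%N = (0 < k)%N.
    move=> kt; have [->|k0] := eqVneq k ord0; last by rewrite front_second // lt0n.
    by apply/negbTE; rewrite -leqNgt ltnW // front_first.
  rewrite [RHS](bigID (fun k : 'I_n.+1 => (k < t)%N)) /=; congr (_ + _)%N.
    apply: eq_bigl => k; case: (eqVneq k t) => [->|/after->//].
    by rewrite !ltnn andbF.
  apply: eq_bigl => k; case: (eqVneq k t) => [->|kt]; first by rewrite !ltnn.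
  rewrite after // -leqNgt ltn_neqAle val_eqE eq_sym kt /=.
  by case: (leqP t k) => [le_tk|_]; rewrite ?andbF // (leq_trans t_gt0 le_tk).
apply: eq_dyson_prod_rank => i j _ _.
have [->|jt] := eqVneq j t.
  have [->|it] := eqVneq i t; first by rewrite !ltnn.
  by rewrite !rank_last_lt.
have [->|it] := eqVneq i t; first by rewrite [LHS]ltnNge [RHS]ltnNge !(ltnW
  (rank_last_lt _ _)).
by rewrite /rank_last /rank_front (negPf it) (negPf jt) ltn_double.
Qed.

(** These are the values killed by the linear factors in
    [mcoeff_natural_front]. *)
Lemma front_tight gamma : packed a front setT gamma ->
  (forall i, gamma i <= d i + (i == ord0))%N ->
  gamma r = prefix_sum a front setT r \/ gamma s = point_first s.
Proof.
move=> pk bnd; case: (packed_first_slack front_inj (in_setT ord0)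
    (fun i _ => @front_first i) pk).
- by move=> i _; rewrite setTD.
- by move=> eqS; left; apply: eqS.
case=> _ eqS; right; rewrite eqS /point_first ?(negPf s0) //.
by rewrite !inE s0.
Qed.

(** In the order with t in front no point survives the two linear factors.  In the
    natural order only the rigid configuration can, and its first factor vanishes
    too when t < r. *)
Lemma mcoeff_natural_front :
  q ^+ skipped * ('X_r * 'X_s * F natural)@_m - ('X_r * 'X_s * F front)@_m =
  (q ^+ prefix_sum a natural setT r - q ^+ prefix_sum a front setT r) *
  (q ^+ prefix_sum a natural setT s - q ^+ point_first s) *
  (q ^+ skipped * qmultinomial q a /
    ((1 - q ^+ (d ord0).+1) * q ^+ prefix_sum a natural setT t)).
Proof.
set u := q ^+ prefix_sum a front setT r; set v := q ^+ point_first s.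
set id := prefix_sum a natural setT.
(* G vanishes wherever x_t = 0 *)
pose G := (q ^+ skipped)%:MP * F natural - F front.
have -> : q ^+ skipped * ('X_r * 'X_s * F natural)@_m - ('X_r * 'X_s * F front)@_m =
    ('X_r * 'X_s * G)@_m.
  by rewrite /G mulrBr mcoeffB -mcoeffCM; congr (_@__ - _); rewrite mulrCA.
have szG : (msize G <= (\sum_i d i).+1)%N.
  rewrite (leq_trans (msizeD_le _ _)) // geq_max msizeN msize_F ?andbT;
    last exact: front_inj.
  by rewrite mul_mpolyC (leq_trans (msizeZ_le _ _)) ?msize_F //; apply: natural_inj.
rewrite (mcoeff_target_shift r s t u v szG).
have szP := msize_target_shift r s t u v szG.
have G_eval x : G.@[x] = q ^+ skipped * dyson_prod q a natural setT x - dyson_prod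
  q a front setT x.
  by rewrite /G mevalB mevalM mevalC !meval_F.
have id_le i : (id i <= d i)%N.
  by rewrite (leq_trans (prefix_sum_le _ _ _ _)) // setTD.
have id_node i : zero_node i (id i) = q ^+ id i.
  rewrite /zero_node; case: eqP => //= ->.
  by rewrite ltn_eqF // ltnS id_le.
have id0 : id ord0 = 0%N.
  by rewrite /id /prefix_sum big1 // => k; rewrite ltn0 andbF.
rewrite (@mcoeff_one_point _ _ zero_node _ _ zero_node_inj szP id); first last.
- move=> gamma le_g; rewrite meval_shifted !mulf_eq0 !negb_or !subr_eq0.
  rewrite {1 2}/zero_node ![_ == t]eq_sym (negPf neq_tr) [t == s]eq_sym (negPf
    neq_st) /=.
  case/andP => /andP[ne_r ne_s]; rewrite G_eval => nzG.
  have not_zero : gamma t != (d t).+1.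
    apply: contraNneq nzG => gt; rewrite dyson_prod_front_zero ?subrr //.
    by rewrite /zero_node gt !eqxx.
  have xE : {in setT, (fun i => zero_node i (gamma i)) =1 (fun i => q ^+ gamma i)}.
    by move=> i _; rewrite /zero_node; case: eqP => //= ->; rewrite (negPf not_zero).
  move: nzG; rewrite !(eq_dyson_prod _ _ _ xE).
  have bnd i : (gamma i <= d i + (i == ord0))%N.
    move: (le_g i); rewrite mnmE; case: (eqVneq i t) => [->|_]; last by rewrite addn0.
    by rewrite (negPf t0) addn0 addn1 leq_eqVlt (negPf not_zero) ltnS.
  have [->|nzf] := eqVneq (dyson_prod q a front setT (fun i => q ^+ gamma i)) 0;
    last first.
    by case: (front_tight (packed_of_neq0 nzf) bnd) => eqS;
      rewrite eqS eqxx in ne_r ne_s.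
  rewrite subr0 mulf_eq0 negb_or => /andP[_ /packed_of_neq0 pk].
  case: (packed_first_slack natural_inj (in_setT ord0) (fun i _ => @natural_first
    i) pk).
  - by move=> i _; rewrite setTD.
  - by move=> eqS i; rewrite eqS ?inE.
  case=> _ eqS; move: ne_s; rewrite eqS ?inE ?s0 // -point_first_natural ?eqxx //.
- by move=> i; apply/target_le/id_le.
rewrite /interp_term meval_shifted G_eval !id_node.
have idE : {in setT, (fun i => zero_node i (id i)) =1 (fun i => q ^+ id i)}.
  by move=> i _; apply: id_node.
rewrite !(eq_dyson_prod _ _ _ idE).
(* unless the linear factors vanish, the front product does *)
have [-> | ne_r] := eqVneq (q ^+ id r) u; first by rewrite subrr !mul0r.
have [-> | ne_s] := eqVneq (q ^+ id s) v; first by rewrite subrr mulr0 !mul0r.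
have -> : dyson_prod q a front setT (fun i => q ^+ id i) = 0.
  apply/eqP; apply: contraT => /packed_of_neq0 pk.
  case: (front_tight pk) => [i|eqS|eqS];
    first by rewrite (leq_trans (id_le i)) ?leq_addr.
    by rewrite eqS eqxx in ne_r.
  by rewrite eqS eqxx in ne_s.
rewrite subr0 dyson_prod_chain_value //; last exact: natural_inj.
rewrite -[LHS]mulrA; congr (_ * _).
rewrite -/id; set W := \prod_i \prod_(l < _ | _) _.
(* the node 0 contributes the factor q^(id t) to the derivative at x_t *)
have -> : W = (node_prod q (d ord0) (id ord0) * (1 - q ^+ (d ord0).+1)) *
    ((node_prod q (d t) (id t) * q ^+ id t) *
    \prod_(i | (i != ord0) && (i != t)) node_prod q (d i) (id i)).
  rewrite /W (bigD1 ord0) //= (bigD1 t) //=; congr (_ * (_ * _)).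
  - have -> : 1 - q ^+ (d ord0).+1 = q ^+ id ord0 - q ^+ (d ord0).+1.
      by rewrite id0 expr0.
    rewrite target_first -node_prodS //.
    apply: eq_bigr => l _.
    by rewrite /zero_node eq_sym (negPf t0).
  - rewrite target_second [LHS]big_mkcond big_ord_recr /= -big_mkcond /=.
    rewrite gtn_eqF ?ltnS ?id_le //= id_node /zero_node !eqxx /= subr0; congr (_ * _).
    by apply: eq_bigr => l _; rewrite (ltn_eqF (ltn_ord l)).
  apply: eq_bigr => i /andP[i0 it]; rewrite target_other //; apply: eq_bigr => l _.
  by rewrite /zero_node (negPf it).
rewrite node_prod_split.
have nz1 := qSX_neq1 q_inj (d ord0); have nz2 := qX_neq0 q_inj (id t).
have := node_prod_neq0 q_inj (d t) (id t).
have := node_prod_neq0 q_inj (d ord0) (id ord0).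
have : \prod_(i | (i != ord0) && (i != t)) node_prod q (d i) (id i) != 0.
  by apply/prodf_neq0 => i _; apply: node_prod_neq0.
move: (\prod_(i | _) _) (node_prod _ _ _) (node_prod _ _ _) => P X Y nzP nzX nzY.
by field; rewrite nz1 nz2 nzX nzY nzP.
Qed.

Lemma natural_prefix_second : prefix_sum a natural setT t = (a0 + skipped)%N.
Proof.
rewrite (prefix_sumD1_before a (in_setT ord0) (natural_first t0)); congr (_ + _)%N.
by apply: eq_bigl => k; rewrite !inE andbT lt0n.
Qed.

Lemma natural_prefix_r :
  prefix_sum a natural setT r = (a0 + between r + (if (t < r)%N then a t else 0))%N.
Proof.
case: ifP => lt_tr.
  have [-> _ _] := @prefix_sum_first_two natural r r0 neq_rt (natural_first r0) lt_tr.
  by rewrite addnAC.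
rewrite (prefix_sumD1_before a (in_setT ord0) (natural_first r0)) addn0;
  congr (_ + _)%N.
apply: eq_bigl => k; rewrite !inE andbT; by case: (eqVneq k t) => [->|_] /=;
  rewrite ?lt_tr ?andbF ?andbT.
Qed.

Lemma Ltilde_skipped : (Ltilde a r s t + skipped = between r + between s)%N.
Proof.
rewrite /Ltilde /prefix_sum.
have mk (P : pred 'I_n.+1) :
    (\sum_(k < n.+1 | P k) a k = \sum_(k < n.+1) P k * a k)%N.
  by rewrite big_mkcond; apply: eq_bigr => k _; case: (P k); rewrite ?mul1n.
rewrite !mk big_distrr /= -!big_split /=.
have neq : (t : nat) != r by exact: neq_tr.
rewrite (fun_if (fun l => l + _)%N) -!big_split /=.
case: ifP => lt_rt; apply: eq_bigr => k _; rewrite ?mulnA -!mulnDl;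
  congr (_ * _)%N; rewrite !inE -!val_eqE /=.
  all: move: neq (natural_first r0) lt_rt lt_ts lt_rs => /=.
  all: move: (nat_of_ord k) (nat_of_ord t) (nat_of_ord r) (nat_of_ord s).
  all: by clear; lia.
Qed.

Lemma asumE : asum a = (a t + rest)%N.
Proof.
rewrite -room_first; apply: eq_bigl => k.
by rewrite !inE -val_eqE lt0n.
Qed.

(** Everything is expressed through the sums over the indices other than 0 and t
    that precede r and s; the rest is an identity of rational functions. *)
Theorem mcoeff_natural :
  ('X_r * 'X_s * F natural)@_m =
  q ^+ Ltilde a r s t
      * (((1 - q ^+ a ord0) * (1 - q ^+ a t)
          * ((1 - q ^+ (a ord0 + asum a + 1))
             + q ^+ Mexp a r t * (1 - q ^+ (asum a + 1 - a t))))
         / ((1 - q ^+ (asum a + 1 - a t)) * (1 - q ^+ (asum a + 1))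
            * (1 - q ^+ (a ord0 + asum a + 1 - a t))))
      * qmultinomial q a.
Proof.
apply: (mulfI (qX_neq0 q_inj skipped)).
rewrite -[q ^+ Ltilde a r s t * _ * _]mulrA [RHS]mulrA -exprD.
rewrite [(skipped + _)%N]addnC Ltilde_skipped.
have /(canRL (subrK _)) -> := mcoeff_natural_front.
have [Sr fr gr] := @prefix_sum_first_two front r r0 neq_rt (front_first r0)
  (front_second r0 neq_rt).
have [Ss fs gs] := @prefix_sum_first_two front s s0 neq_st (front_first s0)
  (front_second s0 neq_st).
have [Ns _ _] := @prefix_sum_first_two natural s s0 neq_st (natural_first s0) lt_ts.
have pfr : point_first r = (a t + between r)%N.
  by rewrite /point_first (negPf r0) fr between_front // eq_sym.
have pfs : point_first s = (a t + between s)%N.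
  by rewrite /point_first (negPf s0) fs between_front // neq_st.
have psr : point_second r = (a0 + between r)%N.
  by rewrite /point_second eq_sym (negPf neq_tr) gr between_front // eq_sym.
have pss : point_second s = (a0 + between s)%N.
  by rewrite /point_second (negPf neq_st) gs between_front // neq_st.
rewrite mcoeff_front pfr pfs psr pss Sr Ns natural_prefix_second natural_prefix_r.
rewrite !between_front ?neq_st //; last by rewrite eq_sym.
rewrite room_first room_second asumE /Mexp asumE.
have -> : (a t + rest + 1 - a t = rest.+1)%N by rewrite -addnA addKn addn1.
have -> : (a0 + (a t + rest) + 1 - a t = (a0 + rest).+1)%N by rewrite addnCA -addnA
  addKn addn1.
rewrite !addn1.
have nzs := qX_neq0 q_inj skipped; have nza := qX_neq0 q_inj a0.
have := qXS_neq1 q_inj (a0 + rest); have := qSX_neq1 q_inj (a0 + rest).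
have := qSX_neq1 q_inj (a t + rest); have := qXS_neq1 q_inj (a t + rest).
have := qSX_neq1 q_inj rest.
have -> : (if (r < t)%N then 1 + (a t + rest) + a0 else a t)%N = (if (t < r)%N then
  a t else (a0 + (a t + rest)).+1)%N.
  have neq : (t : nat) != r by exact: neq_tr.
  by case: (ltngtP t r) neq => // _ _; lia.
case: ifP => _; rewrite !(exprS, exprD) ?addn0 => n1 n2 n3 n4 n5.
all: move: nzs nza n1 n2 n3 n4 n5.
all: move: (q ^+ skipped) (q ^+ a0) (q ^+ a t) (q ^+ rest).
all: move: (q ^+ between r) (q ^+ between s) (qmultinomial _ _).
all: move=> zr zz M zs z0 zt ze nzs nza n1 n2 n3 n4 n5; field.
all: by rewrite nzs nza n1 n2 n3 n4 n5.
Qed.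

End Points.

(** * Constant terms *)

(** Clearing the denominators of a pair of q-shifted factorials. *)
Lemma qpoch_pair (K : fieldType) (q x y : K) (b c : nat) : x != 0 -> y != 0 ->
  qpoch q (x / y) b * qpoch q (y / x * q) c =
  pair_factor q x y b c / (y ^+ b * x ^+ c).
Proof.
move=> nzx nzy; have nz z k : z != 0 -> z ^+ k != 0 :> K by exact: expf_neq0.
have lin (u v w : K) k : v != 0 ->
    \prod_(i < k) (1 - u / v * w * q ^+ i) =
    \prod_(i < k) (v - q ^+ i * (w * u)) / v ^+ k.
  move=> nzv; rewrite -[X in _ / _ ^+ X](card_ord k) -prodr_const -prodf_div.
  by apply: eq_bigr => i _; field.
rewrite /qpoch /pair_factor lin // -[x / y]mulr1 lin // invfM mulrACA.
congr (_ * _ * _); first by apply: eq_bigr => i _; rewrite mul1r.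
by apply: eq_bigr => i _; rewrite exprSr mulrA.
Qed.

Section ConstantTerm.
Variables (K : fieldType) (q : K) (n : nat) (a : 'I_n.+1 -> nat).
Let x (i : 'I_n.+1) : ratfun K n := xvar K i.

Lemma xvar_neq0 i : x i != 0.
Proof.
rewrite tofrac_eq0; apply/eqP => /(congr1 (mcoeff U_(i)%MM)) /eqP.
by rewrite mcoeffXU eqxx mcoeff0 oner_eq0.
Qed.

Lemma qDysonE :
  qDyson x a (ratfunC n q) =
  tofrac (dyson_poly q a (@nat_of_ord n.+1)) /
  \prod_i x i ^+ (\sum_(k in [set~ i]) a k).
Proof.
rewrite /dyson_poly rmorph_dyson_prod dyson_prodT /qDyson.
have -> : \prod_i x i ^+ (\sum_(k in [set~ i]) a k) =
    \prod_(i < n.+1) \prod_(j < n.+1 | (i < j)%N) (x i ^+ a j * x j ^+ a i).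
  rewrite (big_ranked_pairs _ (fun i j : 'I_n.+1 => x i ^+ a j) val_inj) /=.
  by apply: eq_bigr => i _; rewrite expr_sum.
rewrite -prodf_div; apply: eq_bigr => i _; rewrite -prodf_div.
apply: eq_bigr => j _; rewrite qpoch_pair ?xvar_neq0 //.
by rewrite [x j ^+ _ * _]mulrC.
Qed.

Lemma CT_qDyson (r s t : 'I_n.+1) :
  CT (x r * x s / (x ord0 * x t) * qDyson x a (ratfunC n q))
   ('X_r * 'X_s * dyson_poly q a (@nat_of_ord n.+1))@_(target a t).
Proof.
exists ('X_r * 'X_s * dyson_poly q a (@nat_of_ord n.+1)).
exists (target a t); split=> //.
have -> : tofrac 'X_[target a t] = (x ord0 * x t) * \prod_i x i ^+ (\sum_(k in
  [set~ i]) a k).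
  rewrite mpolyXE_id rmorph_prod mulrC.
  have delta (c : 'I_n.+1) : x c = \prod_i x i ^+ (i == c).
    by rewrite (bigD1 c) //= eqxx big1 ?mulr1 // => i /negPf->.
  rewrite [in RHS](delta ord0) [x t]delta -!big_split /=; apply: eq_bigr => i _.
  by rewrite rmorphXn mnmE !exprD mulrA.
by rewrite qDysonE !rmorphM mulrACA -invfM.
Qed.
End ConstantTerm.

Lemma qvar_exp_inj (F : fieldType) : injective (fun k : nat => qvar F ^+ k).
Proof.
move=> k l /eqP; rewrite -!rmorphXn tofrac_eq => /eqP/(congr1 (fun p : {poly F} =>
  size p)).
by rewrite !size_polyXn => -[].
Qed.

Theorem corollary1p6 (F : fieldType) (n : nat) (a : 'I_n.+1 -> nat)
    (r s t : 'I_n.+1) :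
  (3 <= n)%N ->
  (1 <= r)%N -> (r < s)%N ->
  (1 <= t)%N -> (t < s)%N ->
  t != r ->
  let q := qvar F in
  let x := fun i : 'I_n.+1 => xvar (qfield F) i in
  let a0 := a ord0 in
  let A := asum a in
  CT (x r * x s / (x ord0 * x t) * qDyson x a (ratfunC n q))
     (q ^+ Ltilde a r s t
      * (((1 - q ^+ a0) * (1 - q ^+ a t)
          * ((1 - q ^+ (a0 + A + 1))
             + q ^+ Mexp a r t * (1 - q ^+ (A + 1 - a t))))
         / ((1 - q ^+ (A + 1 - a t)) * (1 - q ^+ (A + 1))
            * (1 - q ^+ (a0 + A + 1 - a t))))
      * (qpoch q q (A + a0) / \prod_(i < n.+1) qpoch q q (a i))).
Proof.
move=> _ r_gt0 lt_rs t_gt0 lt_ts neq_tr q x a0 A.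
have nz (i : 'I_n.+1) : (0 < i)%N -> i != ord0 by rewrite lt0n.
have := CT_qDyson q a r s t.
rewrite (mcoeff_natural a (@qvar_exp_inj F)) ?nz //; last exact: leq_ltn_trans lt_rs.
suff -> : qmultinomial q a = qpoch q q (A + a0) / \prod_(i < n.+1) qpoch q q (a i).
  by [].
congr (qpoch _ _ _ / _); rewrite (bigD1 ord0) //= addnC; congr (_ + _)%N.
by apply: eq_bigl => k; rewrite -val_eqE lt0n.
Qed.
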